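(* Let $x^*$ be a stationary point of the nonlinear second-order cone program $\min\{f(x): h(x)=0,\ g(x)\in K\}$, $K=\mathcal{Q}_1\times\cdots\times\mathcal{Q}_s$, with $(\lambda^*,\mu^* )\in\mathcal{M}(x^* )$. Suppose that the constraint nondegeneracy condition $$\begin{pmatrix}\mathcal{J}h(x^* )\\ \mathcal{J}g(x^* )\end{pmatrix}\mathbb{R}^n+\begin{pmatrix}\{0\}\\ \mathrm{lin}(\mathcal{T}_K(g(x^* )))\end{pmatrix}=\begin{pmatrix}\mathbb{R}^m\\ \mathbb{R}^p\end{pmatrix}$$ and the strong second-order sufficient condition $$\big\langle d,\big(\nabla^2_{xx}\mathcal{L}_0(x^*,\lambda^*,\mu^* )+\mathcal{H}(x^*,\mu^* )\big)d\big\rangle>0\qquad\forall d\in\mathrm{aff}(\mathcal{C}(x^* ))\setminus\{0\}$$ hold. Then: (i) $(\lambda^*,\mu^* )$ is the unique element of $\mathcal{M}(x^* )$; (ii) there exist constants $\bar c>0$ and $\eta>0$ such that for any $c\ge\bar c$, $\langle x,\mathcal{A}_{(c,\lambda^*,\mu^* )}(W)x\rangle\ge\eta\|x\|^2$ for all $W\in\partial_B\Pi_K(\mu^*-cg(x^* ))$ and all $x\in\mathbb{R}^n$; (iii) for any $c\ge\bar c$, every $V\in\mathbb{V}_c(\lambda^*,\mu^* )$ satisfies $V\prec0$ (is negative definite).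
   Context: Setting. $f:\mathbb{R}^n\to\mathbb{R}$, $h:\mathbb{R}^n\to\mathbb{R}^m$, $g:\mathbb{R}^n\to\mathbb{R}^p$ are twice continuously differentiable; $\mathcal{Q}_j=\{(\bar\mu_j,\dot\mu_j)\in\mathbb{R}^{r_j}\times\mathbb{R}:\dot\mu_j\ge\|\bar\mu_j\|\}$, $j=1,\dots,s$, and $p=\sum_{j=1}^s(r_j+1)$. Vectors of $\mathbb{R}^p$ are partitioned as $\mu=(\mu_1,\dots,\mu_s)$ with $\mu_j=(\bar\mu_j,\dot\mu_j)\in\mathbb{R}^{r_j}\times\mathbb{R}$, and $g=(g_1,\dots,g_s)$ with $g_j=(\bar g_j,\dot g_j)$, $\dot g_j$ real-valued. $\mathrm{bdry}$ denotes boundary. $\mathcal{J}$ denotes the Jacobian, $\nabla$ its transpose (adjoint). $\Pi_K$ is the Euclidean projection onto $K$. For a locally Lipschitz $F$, differentiable on $D_F$, $\partial_BF(u)=\{\lim_k\mathcal{J}F(u^k):u^k\in D_F,\ u^k\to u\}$. $\mathcal{T}_K(\mu)$ is the tangent cone of the convex set $K$ at $\mu$; $\mathrm{lin}\,U$ is the lineality space (largest linear subspace contained in $U$); $\mathrm{aff}\,U$ is the smallest linear subspace containing $U$. $\mathcal{L}_0(x,\lambda,\mu)=f(x)-\langle\lambda,h(x)\rangle-\langle\mu,g(x)\rangle$. $\mathcal{M}(x)$ is the set of $(\lambda,\mu)\in\mathbb{R}^m\times\mathbb{R}^p$ with $\nabla_x\mathcal{L}_0(x,\lambda,\mu)=0$,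 $h(x)=0$, $g(x)\in K$, $\mu\in K$, $\langle\mu,g(x)\rangle=0$; $x$ is stationary if $\mathcal{M}(x)\neq\emptyset$. Critical cone: $\mathcal{C}(x^* )=\{d\in\mathbb{R}^n:\mathcal{J}h(x^* )d=0,\ \mathcal{J}g(x^* )d\in\mathcal{T}_K(g(x^* ))\cap(\mu^* )^\perp\}$, where $(\mu^* )^\perp$ is the orthogonal complement of $\mu^*$ in $\mathbb{R}^p$. $\mathcal{H}(x^*,\mu^* )=\sum_{j=1}^s\mathcal{H}_j(x^*,\mu^* )$, where $$\mathcal{H}_j(x^*,\mu^* )=-\frac{\dot\mu^*_j}{\dot g_j(x^* )}\nabla g_j(x^* )\begin{pmatrix}-I_{r_j}&0\\0&1\end{pmatrix}\mathcal{J}g_j(x^* )$$ if $g_j(x^* )\in\mathrm{bdry}\,\mathcal{Q}_j\setminus\{0\}$, and $\mathcal{H}_j(x^*,\mu^* )=0$ otherwise. For $c>0$ and $W\in\mathbb{R}^{p\times p}$: $\mathcal{A}_{(c,\lambda^*,\mu^* )}(W)=\nabla^2_{xx}\mathcal{L}_0(x^*,\lambda^*,\mu^* )+c\nabla h(x^* )\mathcal{J}h(x^* )+c\nabla g(x^* )W\mathcal{J}g(x^* )$, and $$\mathbb{V}_c(\lambda^*,\mu^* )=\Big\{-\begin{pmatrix}\mathcal{J}h(x^* )\\ W\mathcal{J}g(x^* )\end{pmatrix}\mathcal{A}_{(c,\lambda^*,\mu^* )}(W)^{-1}\big(\nabla h(x^* ),\nabla g(x^* )W\big)-\begin{pmatrix}0&0\\0&\frac1c(I_p-W)\end{pmatrix}:W\in\partial_B\Pi_K(\mu^*-cg(x^*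 ))\Big\}$$ (well defined for $c\ge\bar c$ by (ii)). *)

(* Defs.v *)
From HB Require Import structures.
From mathcomp Require Import all_boot all_order all_algebra.
From mathcomp Require Import all_classical all_reals all_analysis.
Set Implicit Arguments.
Unset Strict Implicit.
Unset Printing Implicit Defensive.
Import Order.TTheory GRing.Theory Num.Theory.
Import numFieldNormedType.Exports.
Local Open Scope classical_set_scope.
Local Open Scope ring_scope.

(* Vectors are columns.  The library norm on matrices is the max norm; it is
   used only through the topology and differentiability it induces, and every
   metric notion is stated with the Euclidean norm [enorm]. *)

Section euclidean.
Context {R : realType}.

Definition dot (q : nat) (u v : 'cV[R]_q) : R := (u^T *m v) 0 0.

Definition enorm (q : nat) (u : 'cV[R]_q) : R := Num.sqrt (dot u u).

Definition bdry (q : nat) (A : set 'cV[R]_q) : set 'cV[R]_q :=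
  closure A `\` interior A.

Definition is_proj (q : nat) (A : set 'cV[R]_q) (u y : 'cV[R]_q) : Prop :=
  A y /\ forall z, A z -> enorm (u - y) <= enorm (u - z).

Definition eproj (q : nat) (A : set 'cV[R]_q) (u : 'cV[R]_q) : 'cV[R]_q :=
  xget 0 [set y | is_proj A u y].

Definition tangent_cone (q : nat) (A : set 'cV[R]_q) (y : 'cV[R]_q) :
    set 'cV[R]_q :=
  [set d | exists (t : nat -> R) (e : nat -> 'cV[R]_q),
     [/\ forall k, 0 < t k,
         t k @[k --> \oo] --> (0 : R),
         e k @[k --> \oo] --> d
       & forall k, A (y + t k *: e k)]].

(* Union of the linear subspaces contained in U; for a convex cone U this is
   itself a subspace, hence the largest one. *)
Definition lin (q : nat) (U : set 'cV[R]_q) : set 'cV[R]_q :=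
  [set v | exists2 L : {vspace 'cV[R]_q},
     (forall w, w \in L -> U w) & v \in L].

Definition aff (q : nat) (U : set 'cV[R]_q) : set 'cV[R]_q :=
  [set v | forall L : {vspace 'cV[R]_q},
     (forall w, U w -> w \in L) -> v \in L].

(* V < 0 in the Loewner order, so symmetry is part of definiteness. *)
Definition negdef (q : nat) (V : 'M[R]_q) : Prop :=
  V^T = V /\ forall z : 'cV[R]_q, z != 0 -> dot z (V *m z) < 0.

End euclidean.

Section differential.
Context {R : realType}.

(* Continuity of the derivative is tested on each fixed direction, which in
   finite dimension is continuity in the operator norm. *)
Definition C1 (q : nat) (W : normedModType R) (F : 'cV[R]_q -> W) : Prop :=
  (forall x, differentiable F x) /\ (forall v, continuous (fun x => 'd F x v)).

Definition C2 (q : nat) (W : normedModType R) (F : 'cV[R]_q -> W) : Prop :=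
  (forall x, differentiable F x) /\ (forall v, C1 (fun x => 'd F x v)).

(* [jac F x *m v] is ['d F x v]; the library [jacobian] acts on row vectors,
   and is the transpose of this matrix. *)
Definition jac (q k : nat) (F : 'cV[R]_q -> 'cV[R]_k) (x : 'cV[R]_q) :
    'M[R]_(k, q) :=
  \matrix_(i, j) ('d F x (delta_mx j 0)) i 0.

Definition grad (q : nat) (F : 'cV[R]_q -> R) (x : 'cV[R]_q) : 'cV[R]_q :=
  \col_i 'd F x (delta_mx i 0).

Definition hess (q : nat) (F : 'cV[R]_q -> R) (x : 'cV[R]_q) : 'M[R]_q :=
  jac (grad F) x.

Definition Bsubdiff (q k : nat) (F : 'cV[R]_q -> 'cV[R]_k) (u : 'cV[R]_q) :
    set 'M[R]_(k, q) :=
  [set W | exists v : nat -> 'cV[R]_q,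
     [/\ forall i, differentiable F (v i),
         v i @[i --> \oo] --> u
       & jac F (v i) @[i --> \oo] --> W]].

End differential.

Section second_order_cone.
Context {R : realType}.

Definition soc_bar (r : nat) (v : 'cV[R]_(r + 1)) : 'cV[R]_r := usubmx v.

Definition soc_dot (r : nat) (v : 'cV[R]_(r + 1)) : R := dsubmx v 0 0.

Definition soc (r : nat) : set 'cV[R]_(r + 1) :=
  [set v | enorm (soc_bar v) <= soc_dot v].

Definition pdim (s : nat) (r : 'I_s -> nat) : nat := \sum_(j < s) (r j + 1)%N.

Definition blk (s : nat) (r : 'I_s -> nat) (v : 'cV[R]_(pdim r)) (j : 'I_s) :
    'cV[R]_(r j + 1) :=
  submxcol v j.

Definition socprod (s : nat) (r : 'I_s -> nat) : set 'cV[R]_(pdim r) :=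
  [set v | forall j, soc (blk v j)].

End second_order_cone.

Arguments soc {R} r.
Arguments socprod {R s} r.

Section nlsocp.
Context {R : realType} {n m s : nat} {r : 'I_s -> nat}.
Variables (f : 'cV[R]_n -> R) (h : 'cV[R]_n -> 'cV[R]_m).
Variable g : 'cV[R]_n -> 'cV[R]_(pdim r).

Definition lagrangian (lam : 'cV[R]_m) (mu : 'cV[R]_(pdim r))
    (x : 'cV[R]_n) : R :=
  f x - dot lam (h x) - dot mu (g x).

Definition multipliers (x : 'cV[R]_n) : set ('cV[R]_m * 'cV[R]_(pdim r)) :=
  [set z | [/\ grad (lagrangian z.1 z.2) x = 0, h x = 0,
               socprod r (g x), socprod r z.2 & dot z.2 (g x) = 0]].

Definition stationary (x : 'cV[R]_n) : Prop := multipliers x !=set0.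

Definition constraint_nondegenerate (x : 'cV[R]_n) : Prop :=
  [set z : 'cV[R]_(m + pdim r) | exists (d : 'cV[R]_n) (w : 'cV[R]_(pdim r)),
     lin (tangent_cone (socprod r) (g x)) w
     /\ z = col_mx (jac h x) (jac g x) *m d + col_mx 0 w] = setT.

Definition critical_cone (x : 'cV[R]_n) (mu : 'cV[R]_(pdim r)) :
    set 'cV[R]_n :=
  [set d | [/\ jac h x *m d = 0,
               tangent_cone (socprod r) (g x) (jac g x *m d)
             & dot mu (jac g x *m d) = 0]].

Definition sigmaH_block (x : 'cV[R]_n) (mu : 'cV[R]_(pdim r)) (j : 'I_s) :
    'M[R]_n :=
  let gj := fun y => blk (g y) j in
  if `[< (bdry (soc (r j)) `\ 0) (gj x) >] then
    - (soc_dot (blk mu j) / soc_dot (gj x)) *: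
      ((jac gj x)^T *m block_mx (- 1%:M) 0 0 1%:M *m jac gj x)
  else 0.

Definition sigmaH (x : 'cV[R]_n) (mu : 'cV[R]_(pdim r)) : 'M[R]_n :=
  \sum_(j < s) sigmaH_block x mu j.

Definition strong_second_order (x : 'cV[R]_n) (lam : 'cV[R]_m)
    (mu : 'cV[R]_(pdim r)) : Prop :=
  forall d, aff (critical_cone x mu) d -> d != 0 ->
    0 < dot d ((hess (lagrangian lam mu) x + sigmaH x mu) *m d).

Definition Amx (c : R) (x : 'cV[R]_n) (lam : 'cV[R]_m)
    (mu : 'cV[R]_(pdim r)) (W : 'M[R]_(pdim r)) : 'M[R]_n :=
  hess (lagrangian lam mu) x + c *: ((jac h x)^T *m jac h x)
  + c *: ((jac g x)^T *m W *m jac g x).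

Definition dualV (c : R) (x : 'cV[R]_n) (lam : 'cV[R]_m)
    (mu : 'cV[R]_(pdim r)) : set 'M[R]_(m + pdim r) :=
  [set V | exists2 W, Bsubdiff (eproj (socprod r)) (mu - c *: g x) W &
     V = - (col_mx (jac h x) (W *m jac g x) *m invmx (Amx c x lam mu W)
            *m row_mx (jac h x)^T ((jac g x)^T *m W))
         - block_mx 0 0 0 (c^-1 *: (1%:M - W))].

End nlsocp.

(* Main.v *)
(* Off the cone Q and its polar -Q the projection onto Q has an explicit
   Jacobian, while it is the identity on Q and 0 on -Q.  Hence the block W_j of
   a B-subgradient at mu - c g is I, 0 or a limit of these Jacobians; in all
   cases it is symmetric with 0 <= W_j <= I.  With t = mu_j/g_j (last
   components) one finds
     c <z, W_j z> >= c/(t+c) <z, H_j z> + c gap_j(z),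
   up to replacing H_j by a nonnegative form that agrees with it where the
   nonnegative quadratic gap_j vanishes.  By constraint nondegeneracy, the
   common zero set of the gaps and of Jh lies in aff(C), where the second-order
   condition gives positivity; monotonicity in c and compactness of the sphere
   then yield one cbar and one eta.

   For the dual matrices, <z, V z> = 0 with z = (a, b) forces W b = b and
   Jh^T a + Jg^T b = 0.  The fixed vectors of W are differences of elements of
   K orthogonal to g, so b is orthogonal to lin T_K(g) and nondegeneracy gives
   z = 0; uniqueness of the multipliers is the same argument. *)

Require Import Defs.
From HB Require Import structures.
From mathcomp Require Import all_boot all_order all_algebra.
From mathcomp Require Import all_classical all_reals all_analysis.
From mathcomp Require Import ring lra.
Import Order.TTheory GRing.Theory Num.Theory.
Import numFieldNormedType.Exports.
Local Open Scope classical_set_scope.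
Local Open Scope ring_scope.
Set Implicit Arguments.
Unset Strict Implicit.

(** * Euclidean geometry of the second-order cone *)

(** The B-subdifferential at [mu - c g] varies with [c], so a compactness argument over its elements
    would not give constants valid for all large [c]. Each block is therefore bounded below by forms
    free of [W], in which [c] enters only through scalar weights. The weights come from the
    spectrum: at a shifted point outside the cone and its polar, with [g_j] nonzero on the boundary,
    the Jacobian has eigenvalues [0], [1] and [t/(t+c)], and [c * t/(t+c) = c/(t+c) * t] turns
    penalty into the curvature [t] of the sigma term. Replacing every [t] by a common upper bound
    [tau] gives one coefficient for all blocks. The sigma form [t (|z_bar|^2 - z_dot^2)] may be
    negative, which would spoil monotonicity in [c]; putting [<g_bar, z_bar>/g_dot] in place of
    [z_dot] makes it nonnegative.

    It is never decided where the projection is differentiable: its Jacobian is only identified at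
    points where it exists, boundary points included. When [mu_j = g_j = 0] little is known of
    [W_j], but gap and curvature then vanish, so [W_j >= 0] suffices, and orthogonality to [g_j] is
    void. *)

Section dot_theory.
Context {R : realType}.
Implicit Types (q k : nat).

Lemma dotE q (u v : 'cV[R]_q) : dot u v = \sum_i u i 0 * v i 0.
Proof. by rewrite /dot mxE; apply: eq_bigr => i _; rewrite mxE. Qed.

Lemma dotC q (u v : 'cV[R]_q) : dot u v = dot v u.
Proof. by rewrite !dotE; apply: eq_bigr => i _; rewrite mulrC. Qed.

Lemma dotDr q (u v w : 'cV[R]_q) : dot u (v + w) = dot u v + dot u w.
Proof. by rewrite /dot mulmxDr mxE. Qed.

Lemma dotNr q (u v : 'cV[R]_q) : dot u (- v) = - dot u v.
Proof. by rewrite /dot mulmxN mxE. Qed.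

Lemma dotBr q (u v w : 'cV[R]_q) : dot u (v - w) = dot u v - dot u w.
Proof. by rewrite dotDr dotNr. Qed.

Lemma dotZr q a (u v : 'cV[R]_q) : dot u (a *: v) = a * dot u v.
Proof. by rewrite /dot -scalemxAr mxE. Qed.

Lemma dot0r q (u : 'cV[R]_q) : dot u 0 = 0.
Proof. by rewrite /dot mulmx0 mxE. Qed.

Lemma dotDl q (u v w : 'cV[R]_q) : dot (u + v) w = dot u w + dot v w.
Proof. by rewrite !(dotC _ w) dotDr. Qed.

Lemma dotNl q (u v : 'cV[R]_q) : dot (- u) v = - dot u v.
Proof. by rewrite !(dotC _ v) dotNr. Qed.

Lemma dotBl q (u v w : 'cV[R]_q) : dot (u - v) w = dot u w - dot v w.
Proof. by rewrite dotDl dotNl. Qed.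

Lemma dotZl q a (u v : 'cV[R]_q) : dot (a *: u) v = a * dot u v.
Proof. by rewrite !(dotC _ v) dotZr. Qed.

Lemma dot0l q (u : 'cV[R]_q) : dot 0 u = 0.
Proof. by rewrite dotC dot0r. Qed.

Definition dot_lin := (dotDr, dotDl, dotNr, dotNl, dotZr, dotZl, dot0r, dot0l).

Lemma dot_ge0 q (u : 'cV[R]_q) : 0 <= dot u u.
Proof. by rewrite dotE sumr_ge0// => i _; rewrite -expr2 sqr_ge0. Qed.

Lemma dot_eq0 q (u : 'cV[R]_q) : (dot u u == 0) = (u == 0).
Proof.
apply/eqP/eqP => [|->]; last by rewrite dot0r.
rewrite dotE => /eqP; rewrite psumr_eq0 => [/allP u0|i _]; last first.
  by rewrite -expr2 sqr_ge0.
apply/matrixP => i j; rewrite !ord1 mxE; apply/eqP.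
by have := u0 i (mem_index_enum i); rewrite mulf_eq0 orbb.
Qed.

Lemma dot_gt0 q (u : 'cV[R]_q) : (0 < dot u u) = (u != 0).
Proof. by rewrite lt_neqAle dot_ge0 andbT eq_sym dot_eq0. Qed.

Lemma dot_tr q k (A : 'M[R]_(q, k)) u v : dot (A^T *m u) v = dot u (A *m v).
Proof. by rewrite /dot trmx_mul trmxK mulmxA. Qed.

Lemma dot_col_mx q k (u v : 'cV[R]_q) (w z : 'cV[R]_k) :
  dot (col_mx u w) (col_mx v z) = dot u v + dot w z.
Proof. by rewrite /dot tr_col_mx mul_row_col mxE. Qed.

Lemma sqr_enorm q (u : 'cV[R]_q) : enorm u ^+ 2 = dot u u.
Proof. by rewrite sqr_sqrtr ?dot_ge0. Qed.

Lemma enorm_ge0 q (u : 'cV[R]_q) : 0 <= enorm u.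
Proof. exact: sqrtr_ge0. Qed.

Lemma enorm_eq0 q (u : 'cV[R]_q) : (enorm u == 0) = (u == 0).
Proof. by rewrite -dot_eq0 -sqr_enorm sqrf_eq0. Qed.

Lemma enorm_gt0 q (u : 'cV[R]_q) : (0 < enorm u) = (u != 0).
Proof. by rewrite lt_neqAle enorm_ge0 andbT eq_sym enorm_eq0. Qed.

Lemma enorm0 q : enorm (0 : 'cV[R]_q) = 0.
Proof. by apply/eqP; rewrite enorm_eq0. Qed.

Lemma enormZ q a (u : 'cV[R]_q) : enorm (a *: u) = `|a| * enorm u.
Proof.
by rewrite /enorm !dot_lin mulrA -expr2 sqrtrM ?sqr_ge0// sqrtr_sqr.
Qed.

Lemma enormN q (u : 'cV[R]_q) : enorm (- u) = enorm u.
Proof. by rewrite /enorm !dot_lin opprK. Qed.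

Lemma dot_CS q (u v : 'cV[R]_q) : dot u v ^+ 2 <= dot u u * dot v v.
Proof.
have [->|v0] := eqVneq v 0; first by rewrite !dot0r mulr0 expr0n lexx.
have := dot_ge0 (dot v v *: u - dot u v *: v).
rewrite !dot_lin (dotC v u) => H; move: v0; rewrite -dot_gt0 => v0.
rewrite -subr_ge0 -(pmulr_rge0 _ v0); lra.
Qed.

Lemma dot_le_enorm q (u v : 'cV[R]_q) : `|dot u v| <= enorm u * enorm v.
Proof.
rewrite -ler_sqr ?nnegrE ?mulr_ge0 ?enorm_ge0// real_normK ?num_real//.
by rewrite exprMn !sqr_enorm dot_CS.
Qed.

Lemma enormD q (u v : 'cV[R]_q) : enorm (u + v) <= enorm u + enorm v.
Proof.
rewrite -ler_sqr ?nnegrE ?addr_ge0 ?enorm_ge0// sqrrD !sqr_enorm !dot_lin.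
by rewrite (dotC v u); have := le_trans (ler_norm _) (dot_le_enorm u v); lra.
Qed.

End dot_theory.

Section soc_theory.
Context {R : realType} {r : nat}.
Implicit Types (u v w z mu g : 'cV[R]_(r + 1)).

Lemma soc_col_mx v : col_mx (soc_bar v) (soc_dot v)%:M = v.
Proof.
rewrite -[RHS]vsubmxK; congr col_mx.
by apply/matrixP => i j; rewrite !ord1 /soc_dot !mxE eqxx mulr1n.
Qed.

Lemma soc_bar_col (a : 'cV[R]_r) b : soc_bar (col_mx a b%:M) = a.
Proof. exact: col_mxKu. Qed.

Lemma soc_dot_col (a : 'cV[R]_r) b : soc_dot (col_mx a b%:M) = b.
Proof. by rewrite /soc_dot col_mxKd mxE. Qed.

Lemma dot_soc u v :
  dot u v = dot (soc_bar u) (soc_bar v) + soc_dot u * soc_dot v.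
Proof.
rewrite -{1}(soc_col_mx u) -{1}(soc_col_mx v) dot_col_mx; congr (_ + _).
by rewrite dotE big_ord1 !mxE.
Qed.

Lemma soc_ext u v : soc_bar u = soc_bar v -> soc_dot u = soc_dot v -> u = v.
Proof. by move=> e1 e2; rewrite -(soc_col_mx u) e1 e2 soc_col_mx. Qed.

Lemma soc_barD u v : soc_bar (u + v) = soc_bar u + soc_bar v.
Proof. by apply/matrixP => i j; rewrite !mxE. Qed.

Lemma soc_dotD u v : soc_dot (u + v) = soc_dot u + soc_dot v.
Proof. by rewrite /soc_dot !mxE. Qed.

Lemma soc_barZ a u : soc_bar (a *: u) = a *: soc_bar u.
Proof. by apply/matrixP => i j; rewrite !mxE. Qed.

Lemma soc_dotZ a u : soc_dot (a *: u) = a * soc_dot u.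
Proof. by rewrite /soc_dot !mxE. Qed.

Lemma soc_barN u : soc_bar (- u) = - soc_bar u.
Proof. by apply/matrixP => i j; rewrite !mxE. Qed.

Lemma soc_dotN u : soc_dot (- u) = - soc_dot u.
Proof. by rewrite /soc_dot !mxE. Qed.

Lemma soc_bar0 : soc_bar (0 : 'cV[R]_(r + 1)) = 0.
Proof. by apply/matrixP => i j; rewrite !mxE. Qed.

Lemma soc_dot0 : soc_dot (0 : 'cV[R]_(r + 1)) = 0.
Proof. by rewrite /soc_dot !mxE. Qed.

Definition soc_lin := (soc_barD, soc_dotD, soc_barZ, soc_dotZ, soc_barN,
  soc_dotN, soc_bar0, soc_dot0, soc_bar_col, soc_dot_col).

Lemma socE v : soc r v <-> enorm (soc_bar v) <= soc_dot v.
Proof. by []. Qed.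

Lemma soc0 : soc r (0 : 'cV[R]_(r + 1)).
Proof. by rewrite socE !soc_lin enorm0. Qed.

Lemma socD u v : soc r u -> soc r v -> soc r (u + v).
Proof.
rewrite !socE !soc_lin => hu hv; apply: le_trans (enormD _ _) _.
exact: lerD.
Qed.

Lemma socZ a u : 0 <= a -> soc r u -> soc r (a *: u).
Proof.
by rewrite !socE !soc_lin => a0 hu; rewrite enormZ ger0_norm// ler_wpM2l.
Qed.

Lemma soc_dot_ge0 u : soc r u -> 0 <= soc_dot u.
Proof. by rewrite socE; apply: le_trans; exact: enorm_ge0. Qed.

Lemma soc_dual u v : soc r u -> soc r v -> 0 <= dot u v.
Proof.
rewrite !socE dot_soc => hu hv.
have := le_trans (ler_norm _) (dot_le_enorm (- soc_bar u) (soc_bar v)).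
rewrite enormN !dot_lin => h.
have := ler_pM (enorm_ge0 _) (enorm_ge0 _) hu hv; lra.
Qed.

Lemma soc_dot_gt0 u : soc r u -> u != 0 -> 0 < soc_dot u.
Proof.
move=> hu u0; rewrite lt_neqAle soc_dot_ge0// andbT eq_sym.
apply: contra u0 => /eqP d0; move: hu; rewrite socE d0 => b0.
apply/eqP/soc_ext; rewrite !soc_lin//; apply/eqP; rewrite -enorm_eq0.
by rewrite eq_le b0 enorm_ge0.
Qed.

(** Orthogonality in a self-dual cone is equality in Cauchy-Schwarz. Since
    [<mu_bar, g_bar> = - t g_dot^2], expanding [|mu_bar + t g_bar|^2] and bounding both norms by the
    last components gives at most [t^2 g_dot^2 (1 - 2 + 1) = 0]. For [t > 0] the same equality
    leaves no room for [|g_bar| < g_dot]. *)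
Lemma soc_compl g mu : soc r g -> soc r mu -> g != 0 -> dot mu g = 0 ->
  let t := soc_dot mu / soc_dot g in
  [/\ 0 <= t, soc_bar mu = - t *: soc_bar g, soc_dot mu = t * soc_dot g
    & t != 0 -> enorm (soc_bar g) = soc_dot g].
Proof.
move=> Kg Kmu g0 mug t; have gd0 := soc_dot_gt0 Kg g0.
have mud0 := soc_dot_ge0 Kmu.
have t0 : 0 <= t by rewrite divr_ge0// ltW.
have mudE : soc_dot mu = t * soc_dot g by rewrite /t divfK// gt_eqF.
split=> //.
  apply/eqP; rewrite -subr_eq0 -dot_eq0 eq_le dot_ge0 andbT.
  move: mug; rewrite dot_soc mudE !dot_lin (dotC (soc_bar g)) => mug.
  have hm : dot (soc_bar mu) (soc_bar mu) <= (t * soc_dot g) ^+ 2.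
    by rewrite -sqr_enorm ler_sqr ?nnegrE ?enorm_ge0// -?mudE.
  have hg : dot (soc_bar g) (soc_bar g) <= (soc_dot g) ^+ 2.
    by rewrite -sqr_enorm ler_sqr ?nnegrE ?enorm_ge0// ltW.
  have := ler_wpM2l (sqr_ge0 t) hg; nra.
move=> tn0; apply/eqP; rewrite eq_le Kg/=.
have tp : 0 < t by rewrite lt_neqAle eq_sym tn0.
move: mug; rewrite dot_soc mudE => mug.
have := le_trans (ler_norm _) (dot_le_enorm (- soc_bar mu) (soc_bar g)).
rewrite enormN !dot_lin => h.
have h2 : enorm (soc_bar mu) * enorm (soc_bar g) <=
   (t * soc_dot g) * enorm (soc_bar g).
  by rewrite ler_wpM2r ?enorm_ge0// -mudE.
have tg : 0 < t * soc_dot g by rewrite mulr_gt0.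
by rewrite -(ler_pM2l tg); lra.
Qed.

End soc_theory.

Section blocks.
Context {R : realType} {s : nat} {r : 'I_s -> nat}.
Implicit Types (u v w z : 'cV[R]_(pdim r)).

Lemma dot_blk u v : dot u v = \sum_j dot (blk u j) (blk v j).
Proof.
rewrite -{1}(submxcolK u) -{1}(submxcolK v) /dot tr_mxcol mul_mxrow_mxcol.
by rewrite summxE.
Qed.

Lemma blkD u v j : blk (u + v) j = blk u j + blk v j.
Proof. by apply/matrixP => i k; rewrite !mxE. Qed.

Lemma blkN u j : blk (- u) j = - blk u j.
Proof. by apply/matrixP => i k; rewrite !mxE. Qed.

Lemma blkZ a u j : blk (a *: u) j = a *: blk u j.
Proof. by apply/matrixP => i k; rewrite !mxE. Qed.

Lemma blk_mxcol (F : forall j, 'cV[R]_(r j + 1)) j :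
  blk (\mxcol_k F k : 'cV[R]_(pdim r)) j = F j.
Proof. exact: mxcolK. Qed.

Lemma blk_ext u v : (forall j, blk u j = blk v j) -> u = v.
Proof. by move=> uv; apply/mxcolP => j; exact: uv. Qed.

Lemma socprodD u v : socprod r u -> socprod r v -> socprod r (u + v).
Proof. by move=> hu hv j; rewrite blkD; apply: socD. Qed.

Lemma socprodZ a u : 0 <= a -> socprod r u -> socprod r (a *: u).
Proof. by move=> a0 hu j; rewrite blkZ; apply: socZ. Qed.

Lemma socprod_dual u v : socprod r u -> socprod r v -> 0 <= dot u v.
Proof. by move=> hu hv; rewrite dot_blk sumr_ge0// => j _; apply: soc_dual. Qed.

Lemma socprod_compl u v : socprod r u -> socprod r v -> dot u v = 0 ->
  forall j, dot (blk u j) (blk v j) = 0.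
Proof.
move=> hu hv /eqP; rewrite dot_blk psumr_eq0 => [/allP h j|j _].
  by apply/eqP/(h j (mem_index_enum j)).
exact: soc_dual.
Qed.

End blocks.

(** * Calculus *)

Section convergence.
Context {R : realType} {T : Type} {F : set_system T} {FF : Filter F}.

Lemma cvg_bigsum (I : Type) (e : seq I) (f : I -> T -> R) (l : I -> R) :
  (forall i, f i x @[x --> F] --> l i) ->
  (\sum_(i <- e) f i x) @[x --> F] --> \sum_(i <- e) l i.
Proof.
move=> fl; elim: e => [|i e ih].
  by rewrite big_nil; under eq_fun do rewrite big_nil; exact: cvg_cst.
rewrite big_cons; under eq_fun do rewrite big_cons.
by apply: cvgD.
Qed.

Lemma cvg_mx p q (A : T -> 'M[R]_(p, q)) (L : 'M[R]_(p, q)) :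
  (forall i j, A x i j @[x --> F] --> L i j) -> A x @[x --> F] --> L.
Proof.
move=> AL; apply/cvgrPdist_le => /= e e0.
near=> x; rewrite /Num.Def.normr/= mx_normrE (bigmax_le _ (ltW e0))//= => i _.
rewrite !mxE/=; move: i; near: x; apply: filter_forall => /= i.
exact: ((cvgrPdist_le _ _).1 (AL i.1 i.2)).
Unshelve. all: by end_near. Qed.

Lemma cvg_coord p q (A : T -> 'M[R]_(p, q)) (L : 'M[R]_(p, q)) i j :
  A x @[x --> F] --> L -> A x i j @[x --> F] --> L i j.
Proof.
move=> AL.
apply: (@continuous_cvg _ _ _ F FF A (fun M : 'M[R]_(p, q) => M i j : R)) AL.
exact: coord_continuous.
Qed.

Lemma cvg_mulmx p q k (A : T -> 'M[R]_(p, q)) (B : T -> 'M[R]_(q, k))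
    (LA : 'M[R]_(p, q)) (LB : 'M[R]_(q, k)) :
  A x @[x --> F] --> LA -> B x @[x --> F] --> LB ->
  (A x *m B x) @[x --> F] --> LA *m LB.
Proof.
move=> AL BL; apply: cvg_mx => i j; rewrite mxE.
under eq_fun do rewrite mxE.
by apply: cvg_bigsum => l; apply: cvgM; exact: cvg_coord.
Qed.

Lemma cvg_trmx p q (A : T -> 'M[R]_(p, q)) (LA : 'M[R]_(p, q)) :
  A x @[x --> F] --> LA -> (A x)^T @[x --> F] --> LA^T.
Proof.
move=> AL; apply: cvg_mx => i j; rewrite mxE.
by under eq_fun do rewrite mxE; exact: cvg_coord.
Qed.

Lemma cvg_dot q (u v : T -> 'cV[R]_q) (a b : 'cV[R]_q) :
  u x @[x --> F] --> a -> v x @[x --> F] --> b ->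
  dot (u x) (v x) @[x --> F] --> dot a b.
Proof.
by move=> ua vb; apply: cvg_coord; apply: cvg_mulmx => //; exact: cvg_trmx.
Qed.

Lemma cvg_enorm q (u : T -> 'cV[R]_q) (a : 'cV[R]_q) :
  u x @[x --> F] --> a -> enorm (u x) @[x --> F] --> enorm a.
Proof.
move=> ua.
apply: (@continuous_cvg _ _ _ F FF (fun x => dot (u x) (u x)) Num.sqrt).
  exact: sqrt_continuous.
exact: cvg_dot.
Qed.

Lemma cvg_soc_bar q (u : T -> 'cV[R]_(q + 1)) (a : 'cV[R]_(q + 1)) :
  u x @[x --> F] --> a -> soc_bar (u x) @[x --> F] --> soc_bar a.
Proof.
move=> ua; apply: cvg_mx => i j; rewrite mxE.
by under eq_fun do rewrite mxE; exact: cvg_coord.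
Qed.

Lemma cvg_soc_dot q (u : T -> 'cV[R]_(q + 1)) (a : 'cV[R]_(q + 1)) :
  u x @[x --> F] --> a -> soc_dot (u x) @[x --> F] --> soc_dot a.
Proof.
move=> ua; rewrite /soc_dot mxE.
by under eq_fun do rewrite mxE; exact: cvg_coord.
Qed.

Lemma cvg_blk s (r : 'I_s -> nat) (u : T -> 'cV[R]_(pdim r))
    (a : 'cV[R]_(pdim r)) j :
  u x @[x --> F] --> a -> blk (u x) j @[x --> F] --> blk a j.
Proof.
move=> ua; apply: cvg_mx => i k; rewrite mxE.
by under eq_fun do rewrite mxE; exact: cvg_coord.
Qed.

End convergence.

Section differential.
Context {R : realType}.

Lemma jacE q k (F : 'cV[R]_q -> 'cV[R]_k) x v : jac F x *m v = 'd F x v.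
Proof.
rewrite [in RHS](matrix_sum_delta v) linear_sum.
apply/matrixP => i j; rewrite ord1 mxE summxE; apply: eq_bigr => l _.
by rewrite big_ord1 linearZ !mxE mulrC.
Qed.

Lemma is_derive_line (V W : normedModType R) (F : V -> W) (y a : V) (s : R) :
  differentiable F (y + s *: a) ->
  is_derive s (1 : R) (fun s => F (y + s *: a)) ('d F (y + s *: a) a).
Proof.
move=> dF; rewrite -deriveE//.
have E : (fun h : R => h^-1 *: (((fun s => F (y + s *: a)) \o shift s)
    (h *: (1 : R)) - F (y + s *: a))) =
  (fun h => h^-1 *: ((F \o shift (y + s *: a)) (h *: a) - F (y + s *: a))).
  apply/funext => h /=; congr (_ *: (F _ - _)).
  by rewrite [h%:A]mulr1 scalerDl addrCA.
have dFa : derivable F (y + s *: a) a by exact: diff_derivable.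
by split; rewrite /derivable /derive E.
Qed.

Lemma diff_coord (V : normedModType R) p q (F : V -> 'M[R]_(p, q)) x v i j :
  differentiable F x -> 'd F x v i j = 'd (fun y => F y i j) x v.
Proof.
move=> dF.
have dFij : differentiable (fun y => F y i j) x.
  apply: (@differentiable_comp _ _ _ _ F (fun M : 'M[R]_(p, q) => M i j)) => //.
  exact: differentiable_coord.
by rewrite -!deriveE// derive_mx ?mxE//; exact: diff_derivable.
Qed.

Lemma differentiable_cV (V : normedModType R) q (F : V -> 'cV[R]_q) x :
  (forall i, differentiable (fun y => F y i 0) x) -> differentiable F x.
Proof.
move=> dF.
have -> : F = \sum_(i < q) (fun y => F y i 0 *: delta_mx i 0).
  apply/funext => y; rewrite fct_sumE {1}(matrix_sum_delta (F y)).
  by apply: eq_bigr => i _; rewrite big_ord1.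
by apply: differentiable_sum => i; exact: differentiableZl.
Qed.

(** * Symmetry of second derivatives *)

Section schwarz.
Variables (V : normedModType R) (F : V -> R).
Hypothesis dF : forall x, differentiable F x.
Hypothesis ddF : forall v x, differentiable (fun y => 'd F y v) x.

(** The mean value theorem is used twice: along [a] for the increment of [F] in direction [t b],
    then along [b] for ['d F _ a]. *)
Lemma second_difference (x a b : V) (t : R) : 0 < t ->
  exists s1 s2 : R, [/\ 0 < s1 < t, 0 < s2 < t &
    F (x + t *: a + t *: b) - F (x + t *: a) - F (x + t *: b) + F x =
    t ^+ 2 * 'd (fun y => 'd F y a) (x + s1 *: a + s2 *: b) b].
Proof.
move=> t0.
have der1 (s : R) : is_derive s 1
    (fun s => F (x + t *: b + s *: a) - F (x + s *: a))
    ('d F (x + t *: b + s *: a) a - 'd F (x + s *: a) a).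
  by apply: is_deriveB; exact: is_derive_line.
have [s1 s1t E1] : exists2 c, c \in `]0, t[%R & 
    F (x + t *: b + t *: a) - F (x + t *: a) -
      (F (x + t *: b + 0 *: a) - F (x + 0 *: a)) =
    ('d F (x + t *: b + c *: a) a - 'd F (x + c *: a) a) * (t - 0).
  apply: (@MVT R (fun s => F (x + t *: b + s *: a) - F (x + s *: a))) => //.
  apply: derivable_within_continuous => s _.
  exact: ex_derive.
have der2 (s : R) : is_derive s 1
    (fun s => 'd F (x + s1 *: a + s *: b) a)
    ('d (fun y => 'd F y a) (x + s1 *: a + s *: b) b).
  exact: (@is_derive_line _ _ (fun y => 'd F y a)).
have [s2 s2t E2] : exists2 c, c \in `]0, t[%R & 
    'd F (x + s1 *: a + t *: b) a - 'd F (x + s1 *: a + 0 *: b) a =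
    'd (fun y => 'd F y a) (x + s1 *: a + c *: b) b * (t - 0).
  apply: (@MVT R (fun s => 'd F (x + s1 *: a + s *: b) a)) => //.
  apply: derivable_within_continuous => s _.
  exact: ex_derive.
exists s1, s2; split; [by move: s1t; rewrite in_itv|by move: s2t;
  rewrite in_itv|].
move: E1 E2; rewrite !scale0r !addr0 !subr0 (addrAC x (t *: b) (s1 *: a)).
rewrite (addrAC x (t *: b) (t *: a)) => E1 E2.
rewrite expr2 -mulrA (mulrC t ('d _ _ b)) -E2 mulrC -E1; ring.
Qed.

(** The mixed difference is symmetric in [a] and [b], so the two iterated derivatives agree at
    suitable points arbitrarily close to [x]; continuity at [x] carries this to [x]. *)
Lemma diff2_sym (x a b : V) :
  {for x, continuous (fun y => 'd (fun z => 'd F z a) y b)} ->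
  {for x, continuous (fun y => 'd (fun z => 'd F z b) y a)} ->
  'd (fun y => 'd F y a) x b = 'd (fun y => 'd F y b) x a.
Proof.
move=> ca cb; apply/eqP; rewrite -subr_eq0 -normr_le0.
apply/ler_addgt0Pr => e e0; rewrite add0r.
have e2 : 0 < e / 2 by rewrite divr_gt0.
have [d2 /= d20 H2] := (nbhs_ballP _ _).1 ((cvgrPdist_le _ _).1 ca _ e2).
have [d1 /= d10 H1] := (nbhs_ballP _ _).1 ((cvgrPdist_le _ _).1 cb _ e2).
(* With step [min d1 d2 / M] both intermediate points fall within both radii; the [+ 1] keeps [M]
   positive when [a = b = 0]. *)
pose M := `|a| + `|b| + 1.
have M0 : 0 < M by rewrite ltr_wpDl// addr_ge0.
pose t := (Num.min d1 d2) / M.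
have t0 : 0 < t by rewrite divr_gt0// lt_min d10 d20.
have near_x (s1 s2 : R) (u v : V) : 0 < s1 < t -> 0 < s2 < t ->
    `|u| + `|v| = `|a| + `|b| ->
    `|x - (x + s1 *: u + s2 *: v)| < Num.min d1 d2.
  move=> /andP[s10 s1t] /andP[s20 s2t] uv.
  rewrite -addrA opprD addrA subrr sub0r normrN.
  apply: le_lt_trans (ler_normD _ _) _; rewrite !normrZ !gtr0_norm//.
  have -> : Num.min d1 d2 = t * M by rewrite /t divfK// gt_eqF.
  apply: (@le_lt_trans _ _ (t * (`|u| + `|v|))).
    by rewrite mulrDr lerD// ler_wpM2r// ltW.
  by rewrite uv /M ltr_pM2l// ltrDl.
have [s1 [s2 [s1t s2t E1]]] := second_difference x a b t0.
have [r1 [r2 [r1t r2t E2]]] := second_difference x b a t0.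
have E3 : 'd (fun y => 'd F y a) (x + s1 *: a + s2 *: b) b =
    'd (fun y => 'd F y b) (x + r1 *: b + r2 *: a) a.
  have t2 : t ^+ 2 != 0 by rewrite expf_neq0// gt_eqF.
  apply: (mulfI t2); rewrite -E1 -E2 (addrAC x (t *: b)); ring.
have := near_x _ _ a b s1t s2t erefl; rewrite lt_min => /andP[_ b2].
have := near_x _ _ b a r1t r2t (addrC _ _); rewrite lt_min => /andP[b1 _].
have /= h2 := H2 (x + s1 *: a + s2 *: b) _; rewrite -ball_normE in h2.
have /= h1 := H1 (x + r1 *: b + r2 *: a) _; rewrite -ball_normE in h1.
move: (h2 b2) (h1 b1) => {}h2 {}h1.
rewrite -E3 in h1.
set A := 'd _ _ b in h1 h2 *; set B := 'd _ x a in h1 *.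
set C := 'd _ x b in h2 *.
rewrite (_ : C - B = (C - A) - (B - A)); last by ring.
by rewrite (splitr e) (le_trans (ler_normB _ _))// lerD.
Qed.

End schwarz.

(** Needed because [negdef] includes symmetry, so that [Amx] and its inverse must be symmetric. *)
Lemma hess_sym q (F : 'cV[R]_q -> R) x : C2 F -> (hess F x)^T = hess F x.
Proof.
move=> [dF ddF]; apply/matrixP => i j; rewrite !mxE.
have dg y : differentiable (grad F) y.
  apply: differentiable_cV => l;
    rewrite (_ : (fun _ => _) = (fun y => 'd F y (delta_mx l 0))).
    exact: (ddF _).1.
  by apply/funext => z; rewrite mxE.
rewrite !diff_coord//.
have gE l : (fun y => grad F y l 0) = (fun y => 'd F y (delta_mx l 0)).
  by apply/funext => z; rewrite mxE.
rewrite !gE; apply: diff2_sym => //.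
- by move=> v y; exact: (ddF _).1.
- exact: (ddF _).2.
- exact: (ddF _).2.
Qed.

End differential.

(** * Smoothness and gradient of the Lagrangian *)

Section smooth_closure.
Context {R : realType} {q : nat}.

Lemma C1B (W : normedModType R) (F G : 'cV[R]_q -> W) :
  C1 F -> C1 G -> C1 (fun x => F x - G x).
Proof.
move=> [dF cF] [dG cG]; split=> [x|v]; first exact: differentiableB.
rewrite (_ : (fun _ => _) = (fun x => 'd F x v - 'd G x v)).
  by move=> x; apply: (@cvgB _ _ _ (nbhs x) _ (fun y => 'd F y v) (fun y => 'd
    G y v)); [exact: (cF v x)|exact: (cG v x)].
by apply/funext => y; rewrite (_ : (fun _ => _) = F - G)// diffB.
Qed.

Lemma C2B (W : normedModType R) (F G : 'cV[R]_q -> W) :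
  C2 F -> C2 G -> C2 (fun x => F x - G x).
Proof.
move=> [dF cF] [dG cG]; split=> [x|v]; first exact: differentiableB.
rewrite (_ : (fun _ => _) = (fun x => 'd F x v - 'd G x v)).
  by apply: C1B; [exact: cF|exact: cG].
by apply/funext => y; rewrite (_ : (fun _ => _) = F - G)// diffB.
Qed.

Section linear_postcomposition.
Variables (W W' : normedModType R) (L : {linear W -> W'}).
Hypothesis cL : continuous L.

Lemma diff_lin_comp (F : 'cV[R]_q -> W) x v : differentiable F x ->
  'd (fun y => L (F y)) x v = L ('d F x v).
Proof.
move=> dF; have dL : differentiable L (F x) by exact: linear_differentiable.
by rewrite (_ : (fun _ => _) = L \o F)// diff_comp//= diff_lin.
Qed.

Lemma differentiable_lin_comp (F : 'cV[R]_q -> W) x : differentiable F x ->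
  differentiable (fun y => L (F y)) x.
Proof.
move=> dF; apply: (@differentiable_comp _ _ _ _ F L) => //.
exact: linear_differentiable.
Qed.

Lemma C1_lin (F : 'cV[R]_q -> W) : C1 F -> C1 (fun y => L (F y)).
Proof.
move=> [dF cF]; split=> [x|v]; first exact: differentiable_lin_comp.
rewrite (_ : (fun _ => _) = (fun x => L ('d F x v))).
  by move=> x; apply: (@continuous_comp _ _ _ (fun y => 'd F y v) L);
    [exact: (cF v x)|exact: cL].
by apply/funext => y; rewrite diff_lin_comp.
Qed.

Lemma C2_lin (F : 'cV[R]_q -> W) : C2 F -> C2 (fun y => L (F y)).
Proof.
move=> [dF cF]; split=> [x|v]; first exact: differentiable_lin_comp.
rewrite (_ : (fun _ => _) = (fun x => L ('d F x v))); first exact: C1_lin.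
by apply/funext => y; rewrite diff_lin_comp.
Qed.

End linear_postcomposition.

End smooth_closure.

Lemma dot_is_linear (R : realType) k (u : 'cV[R]_k) : linear (dot u).
Proof. by move=> a v w; rewrite dotDr dotZr. Qed.

HB.instance Definition _ (R : realType) k (u : 'cV[R]_k) :=
  GRing.isLinear.Build R 'cV[R]_k R *:%R (dot u) (dot_is_linear u).

Lemma continuous_dot (R : realType) k (u : 'cV[R]_k) :
  continuous (dot u : 'cV[R]_k -> R).
Proof. by move=> v; apply: (@cvg_dot _ _ (nbhs v) _ _ (fun=> u) id);
  [exact: cvg_cst|exact: cvg_id]. Qed.

Lemma blk_is_linear (R : realType) s (r : 'I_s -> nat) j :
  linear (fun v : 'cV[R]_(pdim r) => blk v j).
Proof. by move=> a v w; rewrite blkD blkZ. Qed.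

Lemma jac_blk (R : realType) q s (r : 'I_s -> nat)
    (g : 'cV[R]_q -> 'cV[R]_(pdim r)) j x v : differentiable g x ->
  jac (fun y => blk (g y) j) x *m v = blk (jac g x *m v) j.
Proof.
move=> dg; rewrite !jacE.
pose bM := GRing.isLinear.Build _ _ _ _ _ (@blk_is_linear R s r j).
pose bL : {linear _ -> _} := HB.pack (fun v : 'cV[R]_(pdim r) => blk v j) bM.
by apply: (@diff_lin_comp R q _ _ bL) => // w;
  apply: (@cvg_blk _ _ (nbhs w) _ _ _ id); exact: cvg_id.
Qed.

Section lagrangian_calculus.
Context {R : realType} {n m s : nat} {r : 'I_s -> nat}.
Variables (f : 'cV[R]_n -> R) (h : 'cV[R]_n -> 'cV[R]_m).
Variable g : 'cV[R]_n -> 'cV[R]_(pdim r).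
Hypotheses (f_C2 : C2 f) (h_C2 : C2 h) (g_C2 : C2 g).
Variables (lam : 'cV[R]_m) (mu : 'cV[R]_(pdim r)).

Lemma lagrangian_C2 : C2 (lagrangian f h g lam mu).
Proof.
have lh : C2 (fun y => dot lam (h y)).
  exact: (C2_lin (L := dot lam) (@continuous_dot R m lam) h_C2).
have mg : C2 (fun y => dot mu (g y)).
  exact: (C2_lin (L := dot mu) (@continuous_dot R (pdim r) mu) g_C2).
exact: (C2B (C2B f_C2 lh) mg).
Qed.

Lemma grad_lagrangian x : grad (lagrangian f h g lam mu) x =
  grad f x - (jac h x)^T *m lam - (jac g x)^T *m mu.
Proof.
have df : differentiable f x by exact: f_C2.1.
have dh : differentiable h x by exact: h_C2.1.
have dg : differentiable g x by exact: g_C2.1.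
have dlh : differentiable (fun y => dot lam (h y)) x.
  exact: (differentiable_lin_comp (L := dot lam) (@continuous_dot R m lam) dh).
have dmg : differentiable (fun y => dot mu (g y)) x.
  exact: (differentiable_lin_comp (L := dot mu) (@continuous_dot R (pdim r) mu)
    dg).
apply/matrixP => i j; rewrite ord1 !mxE.
set e := delta_mx i 0.
have -> : 'd (lagrangian f h g lam mu) x e =
    'd f x e - 'd (fun y => dot lam (h y)) x e - 'd (fun y => dot mu (g y)) x e.
  have -> : lagrangian f h g lam mu =
    f - (fun y => dot lam (h y)) - (fun y => dot mu (g y)) by [].
  rewrite diffB//=; last exact: differentiableB.
  by rewrite diffB.
rewrite (diff_lin_comp (L := dot lam) (@continuous_dot R m lam) e dh).
rewrite (diff_lin_comp (L := dot mu) (@continuous_dot R (pdim r) mu) e dg).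
rewrite /= !dotE; congr (_ - _ - _); apply: eq_bigr => l _.
  by rewrite !mxE mulrC.
by rewrite !mxE mulrC.
Qed.

End lagrangian_calculus.

(** * The projection and its B-subdifferential *)

Section soc_projection.
Context {R : realType} {r : nat}.
Implicit Types (u v w y z : 'cV[R]_(r + 1)).

Definition soc_dir v : 'cV[R]_r := (enorm (soc_bar v))^-1 *: soc_bar v.

Definition soc_ratio v : R := soc_dot v / enorm (soc_bar v).

(** The spectral formula: off the cone and its polar, only the eigenvalue
    [soc_dot v + enorm (soc_bar v)] is positive, and its component alone is kept. *)
Definition socproj_out v : 'cV[R]_(r + 1) :=
  (2^-1 * (enorm (soc_bar v) + soc_dot v)) *: col_mx (soc_dir v) 1%:M.

Definition socproj v : 'cV[R]_(r + 1) :=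
  if enorm (soc_bar v) <= soc_dot v then v
  else if enorm (soc_bar v) <= - soc_dot v then 0 else socproj_out v.

Lemma socN_eq0 v : soc r v -> soc r (- v) -> v = 0.
Proof.
rewrite !socE !soc_lin enormN => h1 h2.
have := enorm_ge0 (soc_bar v) => h3.
have d0 : soc_dot v = 0 by apply/eqP; rewrite eq_le; lra.
by apply: soc_ext; rewrite !soc_lin//; apply/eqP; rewrite -enorm_eq0 eq_le; lra.
Qed.

Lemma socproj_in v : soc r v -> socproj v = v.
Proof. by rewrite socE /socproj => ->. Qed.

Lemma socproj_polar v : soc r (- v) -> socproj v = 0.
Proof.
move=> vN; rewrite /socproj; case: ifPn => [h|_]; first exact: socN_eq0.
by move: vN; rewrite socE !soc_lin enormN => ->.
Qed.

Lemma socproj_outE v : ~ soc r v -> ~ soc r (- v) -> socproj v = socproj_out v.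
Proof.
by rewrite !socE !soc_lin enormN => /negP/negbTE h1 /negP/negbTE h2;
  rewrite /socproj h1 h2.
Qed.

Lemma soc_outP v : ~ soc r v -> ~ soc r (- v) ->
  0 < enorm (soc_bar v) /\ `|soc_dot v| < enorm (soc_bar v).
Proof.
rewrite !socE !soc_lin enormN => /negP; rewrite -ltNge => h1 /negP.
rewrite -ltNge => h2.
have h : `|soc_dot v| < enorm (soc_bar v) by rewrite ltr_norml; apply/andP;
  split; lra.
by split=> //; exact: le_lt_trans h.
Qed.

Lemma soc_dir_norm v : 0 < enorm (soc_bar v) ->
  dot (soc_dir v) (soc_dir v) = 1.
Proof.
move=> n0; rewrite /soc_dir !dot_lin -sqr_enorm; field.
by rewrite gt_eqF.
Qed.

(** Moreau's conditions, which characterize the projection onto a self-dual cone. *)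
Lemma socproj_spec v :
  [/\ soc r (socproj v), soc r (socproj v - v)
    & dot (socproj v) (socproj v - v) = 0].
Proof.
have [vQ|vQ] := pselect (soc r v).
  by rewrite socproj_in// subrr dot0r; split=> //; exact: soc0.
have [vN|vN] := pselect (soc r (- v)).
  by rewrite socproj_polar// sub0r dot0l; split=> //; exact: soc0.
have [n0 vd] := soc_outP vQ vN.
rewrite socproj_outE//; set N := enorm (soc_bar v) in n0 vd *.
have [d1 d2] : soc_dot v < N /\ - soc_dot v < N.
  by move: vd; rewrite ltr_norml => /andP[]; lra.
have dirE : soc_bar v = N *: soc_dir v.
  by rewrite /soc_dir scalerA mulfV ?scale1r// gt_eqF.
have e1 : enorm (soc_dir v) = 1 by rewrite /enorm soc_dir_norm// sqrtr1.
(* The residual is the component of the negative eigenvalue, with its sign changed. *)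
have E : socproj_out v - v =
    (2^-1 * (N - soc_dot v)) *: col_mx (- soc_dir v) 1%:M.
  apply: soc_ext; rewrite /socproj_out !soc_lin.
    rewrite -/N dirE scalerN -scaleNr -scaleNr -scalerDl; congr (_ *: _).
    by field.
  by rewrite -/N; field.
split.
- by rewrite /socproj_out -/N; apply: socZ; [lra|rewrite socE !soc_lin e1].
- by rewrite E; apply: socZ; [lra|rewrite socE !soc_lin enormN e1].
- by rewrite E /socproj_out -/N !dot_lin dot_soc !soc_lin dotNr soc_dir_norm//
  mul1r addNr !mulr0.
Qed.

End soc_projection.

Section projection.
Context {R : realType} {s : nat} {r : 'I_s -> nat}.
Implicit Types (u v w y z : 'cV[R]_(pdim r)).

(** Moreau's conditions and self-duality give [|u - y|^2 + |y - z|^2 <= |u - z|^2] for [z] in the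
    cone. This yields existence of a nearest point, which [xget] requires, and its uniqueness, which
    identifies the chosen one. *)
Lemma eproj_socprod u :
  eproj (socprod r) u = \mxcol_j (socproj (blk u j)).
Proof.
set y := \mxcol_j _.
have yK : socprod r y by move=> j; rewrite blk_mxcol;
  case: (socproj_spec (blk u j)).
have yuK : socprod r (y - u).
  by move=> j; rewrite blkD blkN blk_mxcol; case: (socproj_spec (blk u j)).
have yu0 : dot y (y - u) = 0.
  rewrite dot_blk big1// => j _; rewrite blkD blkN blk_mxcol.
  by case: (socproj_spec (blk u j)).
have key z : socprod r z -> dot (u - y) (u - y) + dot (y - z) (y - z) <= dot (u
  - z) (u - z).
  move=> zK; have := socprod_dual zK yuK; move: yu0.
  by rewrite !dot_lin (dotC z u) (dotC u y) (dotC z y); lra.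
have yP : is_proj (socprod r) u y.
  split=> // z /key h; rewrite -ler_sqr ?nnegrE ?enorm_ge0// !sqr_enorm.
  by apply: le_trans h; rewrite lerDl dot_ge0.
have [pK pP] : is_proj (socprod r) u (eproj (socprod r) u).
  exact: (@xgetPex _ _ [set y | is_proj (socprod r) u y] (ex_intro _ y yP)).
have := pP _ yK; rewrite -ler_sqr ?nnegrE ?enorm_ge0// !sqr_enorm => h1.
have := key _ pK => h2; apply/esym/eqP;
  rewrite -subr_eq0 -dot_eq0 eq_le dot_ge0 andbT.
by rewrite -(lerD2l (dot (u - y) (u - y))) addr0 (le_trans h2).
Qed.

End projection.

(** * The Jacobian off the cone and its polar *)

Section soc_jacobian.
Context {R : realType} {r : nat}.
Implicit Types (u v w y z : 'cV[R]_(r + 1)).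

(** Half of the matrix with rows [((1 + k) I - k w w^T, w)] and [(w^T, 1)], applied to [z]. *)
Definition socjac v z : 'cV[R]_(r + 1) :=
  let k := soc_ratio v in let w := soc_dir v in
  2^-1 *: col_mx ((1 + k) *: soc_bar z
                    + (soc_dot z - k * dot w (soc_bar z)) *: w)
                 (dot w (soc_bar z) + soc_dot z)%:M.

Lemma dot_socjac v y z : let k := soc_ratio v in let w := soc_dir v in
  dot y (socjac v z) = 2^-1 * ((1 + k) * dot (soc_bar y) (soc_bar z)
    - k * (dot w (soc_bar y) * dot w (soc_bar z))
    + soc_dot z * dot w (soc_bar y) + soc_dot y * dot w (soc_bar z)
    + soc_dot y * soc_dot z).
Proof.
rewrite /socjac /=; move: (soc_ratio v) (soc_dir v) => k w.
by rewrite dotZr dot_soc !soc_lin dotDr !dotZr (dotC _ w); ring.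
Qed.

(** The spectral form: for a unit [w] and [|k| <= 1] both terms are nonnegative. Limits and block
    bounds are read off from it. *)
Lemma dot_socjac_diag v z : let k := soc_ratio v in let w := soc_dir v in
  dot z (socjac v z) = 2^-1 * ((1 + k) *
     (dot (soc_bar z) (soc_bar z) - dot w (soc_bar z) ^+ 2)
     + (dot w (soc_bar z) + soc_dot z) ^+ 2).
Proof. by move=> k w; rewrite dot_socjac -/k -/w /=; ring. Qed.

Lemma socjac_sym v y z : dot y (socjac v z) = dot (socjac v y) z.
Proof.
by rewrite [RHS]dotC !dot_socjac (dotC (soc_bar z)); ring.
Qed.

(** The eigenvalues are [0], [1] and [(1 + k)/2], the last on vectors [(z_bar, 0)] with [z_bar]
    orthogonal to [w]. Only this one contributes to [S - S^2], with the factor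
    [(1 - k)(1 + k)/4]. *)
Lemma socjac_firm v z : 0 < enorm (soc_bar v) ->
  `|soc_dot v| <= enorm (soc_bar v) ->
  dot (socjac v z) (socjac v z) <= dot z (socjac v z).
Proof.
move=> n0 vd; rewrite dot_socjac_diag.
set k := soc_ratio v; set w := soc_dir v.
have w1 : dot w w = 1 by exact: soc_dir_norm.
have k1 : `|k| <= 1.
  by rewrite normrM normfV (gtr0_norm n0) ler_pdivrMr// mul1r.
have CS := dot_CS w (soc_bar z); rewrite w1 mul1r in CS.
rewrite /socjac -/k -/w; move: k k1 w w1 CS => k k1 w w1 CS.
rewrite !dotZl !dotZr dot_soc !soc_lin.
rewrite !dotDl !dotDr !dotZl !dotZr w1 (dotC (soc_bar z) w).
set a := dot w _ in CS *; set b := dot (soc_bar z) _ in CS *.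
set d := soc_dot z; move: k1; rewrite ler_norml => /andP[k1 k2].
rewrite -subr_ge0 (_ : _ - _ = 4^-1 * ((1 - k) * (1 + k) * (b - a ^+ 2)));
  last by field.
by rewrite !mulr_ge0//; lra.
Qed.

Lemma enorm_line_derive (a b : 'cV[R]_r) : a != 0 ->
  is_derive (0 : R) (1 : R) (fun h : R => enorm (a + h *: b))
    (dot ((enorm a)^-1 *: a) b).
Proof.
move=> a0; have na : enorm a != 0 by rewrite enorm_eq0.
pose p (h : R) : R := dot a a + 2 * dot a b * h + dot b b * h ^+ 2.
have E : (fun h : R => enorm (a + h *: b)) = Num.sqrt \o p.
  apply/funext => h; rewrite /enorm /p /=; congr Num.sqrt.
  by rewrite !dot_lin (dotC b a); ring.
have p0 : p 0 = dot a a by rewrite /p; ring.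
have dp : is_derive (0 : R) (1 : R) p (2 * dot a b).
  by apply: is_derive_eq; rewrite /GRing.scale/=; ring.
have dsq : is_derive (p 0) 1 (Num.sqrt : R -> R) (2 * enorm a)^-1.
  by rewrite /enorm -p0; apply: is_derive1_sqrt; rewrite p0 dot_gt0.
rewrite E; have := is_derive1_comp dsq dp => /is_derive_eq; apply.
by rewrite dotZl; field.
Qed.

Lemma is_derive_mx (A : R -> 'M[R]_(r + 1, 1)) (x : R) dA i j :
  is_derive x (1 : R) A dA -> is_derive x (1 : R) (fun h => A h i j) (dA i j).
Proof.
move=> [ex vE]; split; first exact: (derivable_mxP _ _ _).1.
by rewrite -vE derive_mx ?mxE.
Qed.

(** The outer region is open, so the closed formula holds near [h = 0] and can be differentiated
    entry by entry; uniqueness of derivatives then identifies [l]. *)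
Lemma socproj_line_derive v z l : ~ soc r v -> ~ soc r (- v) ->
  is_derive (0 : R) (1 : R) (fun h : R => socproj (v + h *: z)) l ->
  l = socjac v z.
Proof.
move=> vQ vN dl; have [n0 vd] := soc_outP vQ vN.
have a0 : soc_bar v != 0 by rewrite -enorm_gt0.
set a := soc_bar v in n0 vd a0.
have dN := enorm_line_derive (soc_bar z) a0.
have near_out : \forall h \near (0 : R), socproj (v + h *: z) = socproj_out (v
  + h *: z).
  have c1 : (fun h : R => enorm (soc_bar (v + h *: z)) - `|soc_dot (v + h *:
    z)|) h
      @[h --> (0:R)] --> enorm a - `|soc_dot v|.
    have cl : v + h *: z @[h --> (0:R)] --> v.
      rewrite -[X in _ --> X](addr0 v) -[X in _ + X](scale0r z).
      by apply: cvgD; [exact: cvg_cst|apply: cvgZr_tmp; exact: cvg_id].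
    apply: cvgB; first by apply: cvg_enorm; exact: cvg_soc_bar.
    by apply: cvg_norm; exact: cvg_soc_dot.
  have := cvgr_gt _ c1 0; rewrite subr_gt0 => /(_ _ vd); apply: filterS => h hp.
  rewrite subr_gt0 ltr_norml in hp; move/andP: hp => [h1 h2].
  by apply: socproj_outE; rewrite socE ?soc_lin ?enormN;
    rewrite !soc_lin in h1 h2; lra.
apply/matrixP => i j; rewrite ord1 {j}.
have dli := is_derive_mx i 0 dl.
have {}dli : is_derive (0 : R) (1 : R) (fun h : R => socproj_out (v + h *: z) i
  0) (l i 0).
  by apply: near_eq_is_derive dli; apply: filterS near_out => h ->.
suff d2 : is_derive (0 : R) (1 : R) (fun h : R => socproj_out (v + h *: z) i 0)
    (socjac v z i 0).
  by rewrite -(@derive_val _ _ _ _ _ _ _ dli) -(@derive_val _ _ _ _ _ _ _ d2).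
set b := soc_bar z in dN; set w := soc_dir v.
pose N h := enorm (a + h *: b); rewrite -/N in dN.
change (dot ((enorm a)^-1 *: a) b) with (dot w b) in dN.
have N0 : N 0 = enorm a by rewrite /N scale0r addr0.
have Nn0 : N 0 != 0 by rewrite N0 gt_eqF.
pose V (h : R) := (N h)^-1.
have dV : is_derive (0 : R) (1 : R) V _ := is_deriveV Nn0 dN.
have ai j : a j 0 = N 0 * w j 0.
  by rewrite N0 /w /soc_dir -/a [in RHS]mxE mulrA mulfV ?mul1r// gt_eqF.
have dd : soc_dot v = N 0 * soc_ratio v.
  by rewrite N0 /soc_ratio -/a mulrC divfK// gt_eqF.
set k := soc_ratio v in dd; set e := soc_dot z.
have [j ->|j ->] := split_ordP i.
  have -> : (fun h : R => socproj_out (v + h *: z) (lshift 1 j) 0) =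
    (fun h : R => 2^-1 * (N h + (soc_dot v + h * e)) * (V h * (a j 0 + h * b j
      0))).
    apply/funext => h; rewrite /socproj_out /soc_dir /V /N !soc_lin -/a -/b -/e
      mxE.
    by rewrite col_mxEu !mxE.
  have -> : socjac v z (lshift 1 j) 0 =
      2^-1 * ((1 + k) * b j 0 + (e - k * dot w b) * w j 0).
    by rewrite /socjac mxE col_mxEu !mxE.
  apply: is_derive_eq; rewrite /GRing.scale/= /V ai dd.
  by field.
have -> : (fun h : R => socproj_out (v + h *: z) (rshift r j) 0) =
  (fun h : R => 2^-1 * (N h + (soc_dot v + h * e))).
  apply/funext => h; rewrite /socproj_out /N !soc_lin -/a -/b -/e mxE.
  by rewrite col_mxEd !mxE ord1 eqxx mulr1.
have -> : socjac v z (rshift r j) 0 = 2^-1 * (dot w b + e).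
  by rewrite /socjac mxE col_mxEd !mxE ord1 eqxx mulr1n.
by apply: is_derive_eq; rewrite /GRing.scale/=; field.
Qed.

End soc_jacobian.

(** At a boundary point of the cone the projection is known along one side of a line only; if the
    derivative exists, that side determines it. *)
Lemma is_derive_right (R : realType) (V : normedModType R) (F : R -> V) (l q :
  V) :
  is_derive (0 : R) (1 : R) F l -> (forall h, 0 < h -> F h = F 0 + h *: q) ->
  l = q.
Proof.
move=> [exF <-] Fq; apply/esym.
have cF := cvg_dnbhs_at_right exF.
apply: (cvg_unique (@norm_hausdorff _ V) _ cF).
apply: (@cvg_trans _ ((fun=> q) @ (0 : R)^'+)); last exact: cvg_cst.
apply: near_eq_cvg.
near=> h.
have h0 : 0 < h by near: h; exact: nbhs_right_gt.
by rewrite /= addr0 [h%:A]mulr1 Fq// addrAC subrr add0r scalerA mulVf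
  ?scale1r// gt_eqF.
Unshelve. all: by end_near. Qed.

Section jacobian_blocks.
Context {R : realType} {s : nat} {r : 'I_s -> nat}.
Implicit Types (u v w y z : 'cV[R]_(pdim r)).
Local Notation proj := (eproj (socprod r)).

Definition soc_unit a : 'cV[R]_(pdim r) := \mxcol_j (col_mx 0 a%:M).

Lemma jac_proj_line v j z : differentiable proj v ->
  is_derive (0 : R) (1 : R) (fun h : R => socproj (blk v j + h *: blk z j))
    (blk (jac proj v *m z) j).
Proof.
move=> dp.
pose bM := GRing.isLinear.Build _ _ _ _ _ (@blk_is_linear R s r j).
pose bL : {linear _ -> _} := HB.pack (fun v : 'cV[R]_(pdim r) => blk v j) bM.
have cb : continuous bL.
  by move=> w; apply: (@cvg_blk _ _ (nbhs w) _ _ _ id); exact: cvg_id.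
have v0 : v + (0 : R) *: z = v by rewrite scale0r addr0.
have := @is_derive_line R _ _ (fun y => blk (proj y) j) v z 0.
rewrite v0 => /(_ (differentiable_lin_comp (L := bL) cb dp)).
rewrite -jacE jac_blk//; congr is_derive.
by apply/funext => h; rewrite eproj_socprod blk_mxcol blkD blkZ.
Qed.

Lemma soc_unitP a j : 0 <= a -> soc (r j) (blk (soc_unit a) j).
Proof. by move=> a0; rewrite blk_mxcol socE !soc_lin enorm0. Qed.

(** Hence [z] is a difference of two cone elements, [z + soc_unit a] and [soc_unit a], and a linear
    map is determined by its values on the cone. Summing over the blocks gives one [a] for all of
    them. *)
Lemma soc_sub_unit z : exists2 a, 0 <= a & forall j, soc (r j) (blk (z +
  soc_unit a) j).
Proof.
exists (\sum_j (enorm (soc_bar (blk z j)) + `|soc_dot (blk z j)|)) => [|j].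
  by rewrite sumr_ge0// => j _; rewrite addr_ge0 ?enorm_ge0.
rewrite socE blkD blk_mxcol !soc_lin addr0.
apply: (@le_trans _ _ (soc_dot (blk z j) +
  (enorm (soc_bar (blk z j)) + `|soc_dot (blk z j)|))).
  have := ler_norm (- soc_dot (blk z j)); rewrite normrN; lra.
rewrite lerD2l (bigD1 j)//= lerDl sumr_ge0// => k _.
by rewrite addr_ge0 ?enorm_ge0.
Qed.

(* The directional derivative is computed only along directions in the cone,
   where the projection is affine on a half-line; these directions span. *)
Lemma jac_proj_in v j z : differentiable proj v -> soc (r j) (blk v j) ->
  blk (jac proj v *m z) j = blk z j.
Proof.
move=> dp vQ.
have key q : soc (r j) (blk q j) -> blk (jac proj v *m q) j = blk q j.
  move=> qQ; apply: is_derive_right (jac_proj_line j q dp) _ => h h0.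
  rewrite scale0r addr0 !socproj_in//.
  by apply: socD => //; apply: socZ => //; exact: ltW.
have [a a0 aQ] := soc_sub_unit z.
rewrite -[z in LHS](addrK (soc_unit a)) mulmxBr blkD blkN key// key ?blkD
  ?addrK//.
exact: soc_unitP.
Qed.

Lemma jac_proj_polar v j z : differentiable proj v -> soc (r j) (- blk v j) ->
  blk (jac proj v *m z) j = 0.
Proof.
move=> dp vQ.
(* The half-line runs along [- q], because the polar is stable under subtraction of cone
   elements. *)
have key q : soc (r j) (blk q j) -> blk (jac proj v *m q) j = 0.
  move=> qQ; apply/eqP; rewrite -oppr_eq0 -blkN -mulmxN; apply/eqP.
  apply: is_derive_right (jac_proj_line j (- q) dp) _ => h h0.
  rewrite scale0r scaler0 !addr0 !socproj_polar// opprD blkN scalerN opprK.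
  by apply: socD => //; apply: socZ => //; exact: ltW.
have [a a0 aQ] := soc_sub_unit z.
rewrite -[z in LHS](addrK (soc_unit a)) mulmxBr blkD blkN key// key ?subr0//.
exact: soc_unitP.
Qed.

Lemma jac_proj_out v j z : differentiable proj v ->
  ~ soc (r j) (blk v j) -> ~ soc (r j) (- blk v j) ->
  blk (jac proj v *m z) j = socjac (blk v j) (blk z j).
Proof. by move=> dp vQ vN;
  apply: socproj_line_derive (jac_proj_line j z dp). Qed.

Lemma jac_proj_sym v j y z : differentiable proj v ->
  dot (blk y j) (blk (jac proj v *m z) j) = dot (blk (jac proj v *m y) j) (blk
    z j).
Proof.
move=> dp; have [vQ|vQ] := pselect (soc (r j) (blk v j)).
  by rewrite !jac_proj_in.
have [vN|vN] := pselect (soc (r j) (- blk v j)).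
  by rewrite !jac_proj_polar// dot0l dot0r.
by rewrite !jac_proj_out// socjac_sym.
Qed.

Lemma jac_proj_firm v j z : differentiable proj v ->
  dot (blk (jac proj v *m z) j) (blk (jac proj v *m z) j)
    <= dot (blk z j) (blk (jac proj v *m z) j).
Proof.
move=> dp; have [vQ|vQ] := pselect (soc (r j) (blk v j)).
  by rewrite !jac_proj_in.
have [vN|vN] := pselect (soc (r j) (- blk v j)).
  by rewrite !jac_proj_polar// !dot0r.
rewrite !jac_proj_out//; have [n0 vd] := soc_outP vQ vN.
by apply: socjac_firm => //; exact: ltW.
Qed.

Lemma cvg_near_notin_soc k (T : Type) (F : set_system T) (FF : Filter F)
    (x : T -> 'cV[R]_(k + 1)) (a : 'cV[R]_(k + 1)) :
  x t @[t --> F] --> a -> ~ soc k a -> \forall t \near F, ~ soc k (x t).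
Proof.
move=> xa /negP; rewrite -ltNge -subr_gt0 => aQ.
have c : enorm (soc_bar (x t)) - soc_dot (x t) @[t --> F] -->
    enorm (soc_bar a) - soc_dot a.
  by apply: cvgB; [apply: cvg_enorm; exact: cvg_soc_bar|exact: cvg_soc_dot].
have := @cvgr_gt R T F FF _ _ c _ aQ; apply: filterS => t.
by rewrite subr_gt0 ltNge => /negP.
Qed.

Lemma cvg_near_neq k (T : Type) (F : set_system T) (FF : Filter F)
    (x : T -> 'cV[R]_k) (a b : 'cV[R]_k) :
  x t @[t --> F] --> a -> a != b -> \forall t \near F, x t != b.
Proof.
move=> xa; rewrite -subr_eq0 -dot_gt0 => ab.
have c : x t - b @[t --> F] --> a - b by apply: cvgB => //; exact: cvg_cst.
have := @cvgr_gt R T F FF _ _ (@cvg_dot R T F FF _ _ _ _ _ c c) _ ab;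
  apply: filterS => t.
by rewrite dot_gt0 subr_eq0.
Qed.

(** * B-subgradients as limits of Jacobians *)

Section subdifferential.
Variables (u : 'cV[R]_(pdim r)) (W : 'M[R]_(pdim r)).
Hypothesis uW : Bsubdiff proj u W.

Lemma cvg_dot_blk j (J : nat -> 'M[R]_(pdim r)) y z :
  J i @[i --> \oo] --> W ->
  dot (blk y j) (blk (J i *m z) j) @[i --> \oo] --> dot (blk y j) (blk (W *m z)
    j).
Proof.
move=> JW; apply: cvg_dot; first exact: cvg_cst.
by apply: cvg_blk; apply: cvg_mulmx => //; exact: cvg_cst.
Qed.

Lemma Bsubdiff_sym : W^T = W.
Proof.
have [v [dv vu JW]] := uW.
have key y z : dot y (W *m z) = dot (W *m y) z.
  rewrite !dot_blk; apply: eq_bigr => j _; rewrite [RHS]dotC.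
  have := (@cvg_dot_blk j _ y z JW).
  under eq_fun do rewrite jac_proj_sym// dotC.
  move=> c1.
  exact: (cvg_unique (@norm_hausdorff _ R) c1 (@cvg_dot_blk j _ z y JW)).
apply/matrixP => i j.
have := key (delta_mx j 0) (delta_mx i 0).
by rewrite [RHS]dotC /dot !trmx_delta -!rowE -!colE !mxE => ->.
Qed.

Lemma Bsubdiff_firm j z :
  dot (blk (W *m z) j) (blk (W *m z) j) <= dot (blk z j) (blk (W *m z) j).
Proof.
have [v [dv vu JW]] := uW.
have c1 := (@cvg_dot_blk j _ z z JW).
have cW : blk (jac proj (v i) *m z) j @[i --> \oo] --> blk (W *m z) j.
  by apply: cvg_blk; apply: cvg_mulmx => //; exact: cvg_cst.
have c2 : dot (blk (jac proj (v i) *m z) j) (blk (jac proj (v i) *m z) j)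
    @[i --> \oo] --> dot (blk (W *m z) j) (blk (W *m z) j) by exact: cvg_dot.
apply: ler_cvg_to c2 c1 _.
by apply: nearW => i; exact: jac_proj_firm.
Qed.

Lemma Bsubdiff_ge0 j z : 0 <= dot (blk z j) (blk (W *m z) j).
Proof. exact: le_trans (dot_ge0 _) (Bsubdiff_firm j z). Qed.

(* The third case says nothing about [W] when the vector part of [u] is zero;
   then [u = 0], and for [u = mu - c g] this means [mu = g = 0]. *)
Lemma Bsubdiff_cases j :
  [\/ soc (r j) (blk u j) /\ (forall z, blk (W *m z) j = blk z j),
      soc (r j) (- blk u j) /\ (forall z, blk (W *m z) j = 0)
    | `|soc_dot (blk u j)| <= enorm (soc_bar (blk u j)) /\
      (soc_bar (blk u j) != 0 -> forall z,
        dot (blk z j) (blk (W *m z) j) = dot (blk z j) (socjac (blk u j) (blk z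
          j)))].
Proof.
have [v [dv vu JW]] := uW.
have cvj : blk (v i) j @[i --> \oo] --> blk u j by exact: cvg_blk.
have cW z : blk (jac proj (v i) *m z) j @[i --> \oo] --> blk (W *m z) j.
  by apply: cvg_blk; apply: cvg_mulmx => //; exact: cvg_cst.
(* If the limit point lies outside the closed cone, so do the points eventually. Otherwise the block
   of [W] differs from [L] at some [z], hence so do the Jacobians eventually, and this again
   excludes the cone. It is used for the cone with [L = id] and for the polar with [L = 0]. *)
have near_out (x : nat -> 'cV[R]_(r j + 1)) (a : 'cV[R]_(r j + 1))
    (L : 'cV[R]_(r j + 1) -> 'cV[R]_(r j + 1)) :
    x i @[i --> \oo] --> a ->
    ~ (soc (r j) a /\ forall z, blk (W *m z) j = L (blk z j)) ->
    (forall i z, soc (r j) (x i) -> blk (jac proj (v i) *m z) j = L (blk z j))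
      ->
    \forall i \near \oo, ~ soc (r j) (x i).
  move=> xa H Hi; have [uQ|uQ] := pselect (soc (r j) a); last first.
    exact: cvg_near_notin_soc uQ.
  have /existsNP[z /eqP Wz] : ~ forall z, blk (W *m z) j = L (blk z j).
    by move=> ?; exact: H.
  have := cvg_near_neq eventually_filter (cW z) Wz;
    apply: filterS => i /eqP h vQ.
  by apply: h; exact: Hi.
have [A|A] := pselect (soc (r j) (blk u j) /\ (forall z, blk (W *m z) j = blk z
  j)).
  exact: Or31.
have [B|B] := pselect (soc (r j) (- blk u j) /\ (forall z, blk (W *m z) j = 0)).
  exact: Or32.
apply: Or33.
have outQ : \forall i \near \oo, ~ soc (r j) (blk (v i) j).
  by apply: (near_out _ _ id cvj A) => i z; exact: jac_proj_in.
have outN : \forall i \near \oo, ~ soc (r j) (- blk (v i) j).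
  by apply: (near_out _ _ (fun=> 0) (cvgN cvj) B) => i z; exact: jac_proj_polar.
split.
  have c1 : enorm (soc_bar (blk (v i) j)) - `|soc_dot (blk (v i) j)| @[i -->
    \oo]
      --> enorm (soc_bar (blk u j)) - `|soc_dot (blk u j)|.
    apply: cvgB; first by apply: cvg_enorm; exact: cvg_soc_bar.
    by apply: cvg_norm; exact: cvg_soc_dot.
  rewrite -subr_ge0 -(cvg_lim _ c1)//; apply: limr_ge.
    by apply/cvg_ex; eexists; exact: c1.
  near=> i; rewrite subr_ge0 ltW//.
  have vQ : ~ soc (r j) (blk (v i) j) by near: i.
  have vN : ~ soc (r j) (- blk (v i) j) by near: i.
  by case: (soc_outP vQ vN).
rewrite -enorm_eq0 => u0 z.
have cn : enorm (soc_bar (blk (v i) j)) @[i --> \oo] --> enorm (soc_bar (blk u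
  j)).
  by apply: cvg_enorm; exact: cvg_soc_bar.
have cV : (enorm (soc_bar (blk (v i) j)))^-1 @[i --> \oo] --> (enorm (soc_bar
  (blk u j)))^-1.
  exact: cvgV.
have cdir : soc_dir (blk (v i) j) @[i --> \oo] --> soc_dir (blk u j).
  by apply: cvgZ => //; exact: cvg_soc_bar.
have crat : soc_ratio (blk (v i) j) @[i --> \oo] --> soc_ratio (blk u j).
  by apply: cvgM => //; exact: cvg_soc_dot.
set b := dot (soc_bar (blk z j)) (soc_bar (blk z j)).
have cd : dot (soc_dir (blk (v i) j)) (soc_bar (blk z j)) @[i --> \oo] -->
    dot (soc_dir (blk u j)) (soc_bar (blk z j)).
  by apply: cvg_dot => //; exact: cvg_cst.
have c1 : 1 + soc_ratio (blk (v i) j) @[i --> \oo] --> 1 + soc_ratio (blk u j).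
  by apply: cvgD => //; exact: cvg_cst.
have c2 : b - dot (soc_dir (blk (v i) j)) (soc_bar (blk z j)) ^+ 2 @[i --> \oo]
    --> b - dot (soc_dir (blk u j)) (soc_bar (blk z j)) ^+ 2.
  by apply: cvgB; [exact: cvg_cst|apply: cvgM].
have c3 : dot (soc_dir (blk (v i) j)) (soc_bar (blk z j)) + soc_dot (blk z j)
    @[i --> \oo] --> dot (soc_dir (blk u j)) (soc_bar (blk z j)) + soc_dot (blk
      z j).
  by apply: cvgD => //; exact: cvg_cst.
have lim : dot (blk z j) (socjac (blk (v i) j) (blk z j)) @[i --> \oo] -->
    dot (blk z j) (socjac (blk u j) (blk z j)).
  rewrite dot_socjac_diag; under eq_fun do rewrite dot_socjac_diag.
  apply: (@cvgM _ _ _ _ (fun=> 2^-1)); first exact: cvg_cst.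
  by apply: cvgD; [exact: (cvgM c1 c2)|exact: (cvgM c3 c3)].
apply: (cvg_unique (@norm_hausdorff _ R) (@cvg_dot_blk j _ z z JW)).
apply: cvg_trans lim; apply: near_eq_cvg; near=> i.
by rewrite jac_proj_out//; near: i.
Unshelve. all: by end_near. Qed.

End subdifferential.

End jacobian_blocks.

(** * Tangent cones and constraint nondegeneracy *)

Section tangent_cones.
Context {R : realType} {s : nat} {r : 'I_s -> nat}.
Implicit Types (u v w y z g mu nu : 'cV[R]_(pdim r)).
Local Notation K := (socprod r).

(** [- nu] is normal to the cone at [g]: self-duality at [g + t e], with [<nu, g> = 0], leaves
    [t <nu, e> >= 0]. *)
Lemma tangent_dual nu g z : K nu -> dot nu g = 0 -> tangent_cone K g z ->
  0 <= dot nu z.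
Proof.
move=> nuK nug [t [e [t0 _ ez tK]]].
have c : dot nu (e k) @[k --> \oo] --> dot nu z.
  by apply: cvg_dot => //; exact: cvg_cst.
apply: (ler_cvg_to (cvg_cst (0 : R)) c); apply: nearW => k.
have := socprod_dual nuK (tK k).
by rewrite dotDr nug add0r dotZr pmulr_rge0.
Qed.

Lemma lin_sub (q : nat) (U : set 'cV[R]_q) (w : 'cV[R]_q) : lin U w -> U w /\
  lin U (- w).
Proof.
move=> [L LU wL]; split; first exact: LU.
by exists L => //; rewrite rpredN.
Qed.

Lemma lin_tangent_perp nu g w : K nu -> dot nu g = 0 ->
  lin (tangent_cone K g) w -> dot nu w = 0.
Proof.
move=> nuK nug /lin_sub[wT /lin_sub[wNT _]].
have := tangent_dual nuK nug wT; have := tangent_dual nuK nug wNT.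
by rewrite dotNr => h1 h2; apply/eqP; rewrite eq_le h2 andbT; lra.
Qed.

(* Points [g + t y] and [g + t' z] of the cone are combined with the weights
   that equalize the two step lengths. *)
Lemma tangentD g y z : tangent_cone K g y -> tangent_cone K g z ->
  tangent_cone K g (y + z).
Proof.
move=> [t [e [t0 tc ec tK]]] [t' [e' [t'0 t'c e'c t'K]]].
pose l k := t' k / (t k + t' k).
have tt k : 0 < t k + t' k by rewrite addr_gt0.
have l0 k : 0 < l k by rewrite divr_gt0.
have l1 k : l k < 1 by rewrite ltr_pdivrMr// mul1r ltrDr.
exists (fun k => l k * t k), (fun k => e k + e' k); split.
- by move=> k; rewrite mulr_gt0.
- apply: (@squeeze_cvgr _ _ _ _ (fun=> 0) t) => //; last exact: cvg_cst.
  apply: nearW => k; apply/andP; split; first by rewrite mulr_ge0// ltW.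
  by rewrite ler_piMl// ltW.
- exact: cvgD.
- move=> k; have -> : g + (l k * t k) *: (e k + e' k) =
      l k *: (g + t k *: e k) + (1 - l k) *: (g + t' k *: e' k).
    have -> : l k * t k = (1 - l k) * t' k.
      by rewrite /l; field; rewrite gt_eqF.
    rewrite scalerDr [in RHS]scalerDr [X in _ = _ + X]scalerDr !scalerA.
    have -> : l k * t k = (1 - l k) * t' k.
      by rewrite /l; field; rewrite gt_eqF.
    by rewrite addrACA -scalerDl (_ : l k + (1 - l k) = 1) ?scale1r//; ring.
  by apply: socprodD; apply: socprodZ => //; [exact: ltW|rewrite subr_ge0 ltW].
Qed.

Lemma tangent_add_lin g y w : tangent_cone K g y -> lin (tangent_cone K g) w ->
  tangent_cone K g (y - w).
Proof. by move=> yT /lin_sub[_ /lin_sub[wT _]]; exact: tangentD. Qed.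

(* In a tangent block the curve [g + t z + t^2 C e], with [e] the axis of the
   cone, stays in the cone for small [t]. *)
Lemma tangent_blocks g z : K g ->
  (forall j, soc (r j) (blk z j) \/
    [/\ enorm (soc_bar (blk g j)) = soc_dot (blk g j), 0 < soc_dot (blk g j)
      & dot (soc_bar (blk g j)) (soc_bar (blk z j)) =
        soc_dot (blk g j) * soc_dot (blk z j)]) ->
  tangent_cone K g z.
Proof.
move=> gK zT.
(* [C j] is chosen so that the term [t^2 |z_bar|^2 = t^2 C g_dot] of the squared norm is absorbed by
   [2 t^2 C (g_dot + t z_dot)]. If [soc_dot (blk g j) = 0] it is [0], and such a block falls under
   the first alternative. *)
pose C j := dot (soc_bar (blk z j)) (soc_bar (blk z j)) / soc_dot (blk g j).
have gd j : 0 <= soc_dot (blk g j) by exact: soc_dot_ge0.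
have C0 j : 0 <= C j by rewrite divr_ge0 ?dot_ge0.
pose E : 'cV[R]_(pdim r) := \mxcol_j (col_mx 0 (C j)%:M).
(* Steps [t <= 1/S] ensure [g_dot + t z_dot >= g_dot / 2] in every tangent block, which is what the
   absorption needs. *)
pose S := 1 + \sum_j (2 * `|soc_dot (blk z j)| / soc_dot (blk g j)).
have sum0 : 0 <= \sum_j (2 * `|soc_dot (blk z j)| / soc_dot (blk g j)).
  by apply: sumr_ge0 => j _; rewrite divr_ge0// mulr_ge0.
have S0 : 0 < S by rewrite /S; lra.
pose t (k : nat) : R := S^-1 * k.+1%:R^-1.
have t0 k : 0 < t k by rewrite mulr_gt0 ?invr_gt0.
have tS k : t k * S <= 1.
  by rewrite /t mulrAC mulVf ?gt_eqF// mul1r invf_le1// ler1n.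
have tc : t k @[k --> \oo] --> (0 : R).
  rewrite -(mulr0 S^-1); apply: (@cvgM _ _ _ _ (fun=> S^-1));
    first exact: cvg_cst.
  exact: cvg_harmonic.
exists t, (fun k => z + t k *: E); split => //.
  rewrite -[X in _ --> X]addr0 -(scale0r E).
  by apply: cvgD; [exact: cvg_cst|exact: cvgZr_tmp].
move=> k j; have {}t0 := t0 k; have {}tS := tS k; move: (t k) t0 tS => a a0 aS.
rewrite blkD blkZ blkD blkZ blk_mxcol.
have EQ : soc (r j) (col_mx 0 (C j)%:M) by rewrite socE !soc_lin enorm0.
have [zQ|[gb g0 gz]] := zT j.
  apply: socD => //; apply: socZ; first exact: ltW.
  by apply: socD => //; apply: socZ => //; exact: ltW.
have aj : a * (2 * `|soc_dot (blk z j)|) <= soc_dot (blk g j).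
  rewrite -[leRHS]mul1r -ler_pdivrMr// -mulrA; apply: le_trans aS;
    rewrite ler_pM2l//.
  rewrite /S (bigD1 j)//= [1 + _]addrCA lerDl addr_ge0// sumr_ge0// => i _.
  by rewrite divr_ge0// mulr_ge0.
have CE : C j * soc_dot (blk g j) = dot (soc_bar (blk z j)) (soc_bar (blk z j)).
  by rewrite /C divfK// gt_eqF.
rewrite socE !soc_lin scaler0 addr0.
have zd := ler_norm (- soc_dot (blk z j)); rewrite normrN in zd.
move: (C0 j) => Cj0; set c := C j in Cj0 CE *.
set gj := soc_dot (blk g j) in g0 gz aj CE gb *;
  set zj := soc_dot (blk z j) in gz zd aj *.
have X0 : gj <= 2 * (gj + a * zj) by have := ler_wpM2l (ltW a0) zd; lra.
have ac : 0 <= a * (a * c) by do ?apply: mulr_ge0 => //; exact: ltW.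
have Y0 : 0 <= gj + a * (zj + a * c) by rewrite mulrDr; lra.
rewrite -ler_sqr ?nnegrE ?enorm_ge0// sqr_enorm !dotDl !dotDr !dotZl !dotZr.
rewrite (dotC (soc_bar (blk z j)) (soc_bar (blk g j))) gz -sqr_enorm gb -CE.
have := mulr_ge0 ac (ltW g0).
have h := ler_wpM2l ac X0.
have := sqr_ge0 (a * zj); have := sqr_ge0 (a * (a * c)); lra.
Qed.

End tangent_cones.

Section nondegeneracy.
Context {R : realType} {n m s : nat} {r : 'I_s -> nat}.
Variables (h : 'cV[R]_n -> 'cV[R]_m) (g : 'cV[R]_n -> 'cV[R]_(pdim r)).
Variable x : 'cV[R]_n.
Hypothesis nondeg : constraint_nondegenerate h g x.
Local Notation K := (socprod r).
Local Notation T := (tangent_cone K (g x)).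

Lemma nondegP a b : exists d w, [/\ lin T w, a = jac h x *m d
  & b = jac g x *m d + w].
Proof.
have : [set: 'cV[R]_(m + pdim r)] (col_mx a b) by [].
rewrite -nondeg => -[d [w [wT]]].
rewrite mul_col_mx add_col_mx addr0 => /eq_col_mx[-> ->].
by exists d, w.
Qed.

(** The dual form of a surjectivity condition: [(a, b)] is itself of the form [(Jh d, Jg d + w)],
    and pairing it with that expression gives [|a|^2 + |b|^2 = 0]. *)
Lemma nondeg_dual a b : (jac h x)^T *m a + (jac g x)^T *m b = 0 ->
  (forall w, lin T w -> dot b w = 0) -> a = 0 /\ b = 0.
Proof.
move=> ab0 bw; have [d [w [wT aE bE]]] := nondegP a b.
have : dot a a + dot b b = 0.
  rewrite {2}aE {2}bE dotDr (bw _ wT) addr0 -!dot_tr -dotDl.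
  by rewrite ab0 dot0l.
move/eqP; rewrite paddr_eq0 ?dot_ge0// !dot_eq0 => /andP[/eqP-> /eqP->].
by [].
Qed.

(* Nondegeneracy corrects [z] by a lineality direction [w] so that [z - w] is
   the image of some critical [d2]; then [d + d2] is critical as well. *)
Lemma aff_critical mu d y z : K mu -> dot mu (g x) = 0 ->
  jac h x *m d = 0 -> jac g x *m d = y - z ->
  T y -> T z -> dot mu y = 0 -> dot mu z = 0 ->
  aff (critical_cone h g x mu) d.
Proof.
move=> muK mug hd gd yT zT muy muz L CL.
have [d2 [w [wT /esym hd2 zE]]] := nondegP 0 z.
have gd2 : jac g x *m d2 = z - w by rewrite zE addrK.
have muw := lin_tangent_perp muK mug wT.
rewrite -[d](addrK d2); apply: rpredB; apply: CL; split.
- by rewrite mulmxDr hd hd2 addr0.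
- rewrite mulmxDr gd gd2 addrA subrK; exact: tangent_add_lin.
- by rewrite mulmxDr gd gd2 addrA subrK dotBr muy muw subr0.
- by [].
- by rewrite gd2; exact: tangent_add_lin.
- by rewrite gd2 dotBr muz muw subr0.
Qed.

End nondegeneracy.

(** * Coercivity for large penalties *)

(** Stated for rows, to which [bounded_closed_compact] and later [EVT_min_rV] apply; hence the
    transposes. Boundedness holds because the max norm is at most the Euclidean one. *)
Lemma compact_unit_sphere (R : realType) n :
  compact [set v : 'rV[R]_n | dot v^T v^T = 1].
Proof.
apply: bounded_closed_compact.
  exists 1; split; first exact: num_real.
  move=> M M1 v /= v1; apply: le_trans (ltW M1).
  rewrite /Num.Def.normr/= mx_normrE; apply: bigmax_le => // -[i j] _ /=.
  rewrite ord1 -ler_sqr ?nnegrE// expr1n real_normK ?num_real// -v1 dotE.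
  rewrite (bigD1 j)//= !mxE -expr2 lerDl sumr_ge0// => k _.
  by rewrite !mxE -expr2 sqr_ge0.
have c : continuous (fun v : 'rV[R]_n => dot v^T v^T).
  move=> v.
  by apply: (@cvg_dot _ _ (nbhs v)); apply: (@cvg_trmx _ _ (nbhs v));
    exact: cvg_id.
rewrite (_ : [set v | _] = (fun v : 'rV[R]_n => dot v^T v^T) @^-1` [set 1]) //.
apply: closed_comp; first by move=> v _; exact: c.
exact: closed_eq.
Qed.

Section penalty.
Context {R : realType} {n : nat}.
Variables (H P B : 'cV[R]_n -> R) (tau : R).
Hypotheses (H_hom : forall a d, H (a *: d) = a ^+ 2 * H d)
  (P_hom : forall a d, P (a *: d) = a ^+ 2 * P d)
  (B_hom : forall a d, B (a *: d) = a ^+ 2 * B d).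
Hypotheses (H_cont : continuous H) (P_cont : continuous P) (B_cont : continuous
  B).
Hypotheses (P_ge0 : forall d, 0 <= P d) (B_ge0 : forall d, 0 <= B d).
Hypothesis tau_ge0 : 0 <= tau.
Hypothesis pos : forall d, d != 0 -> B d = 0 -> 0 < H d + P d.

Let q c d : R := H d + c / (tau + c) * P d + c * B d.

Let ratio_le c c' : 0 < c -> c <= c' -> c / (tau + c) <= c' / (tau + c').
Proof.
move=> c0 cc'.
have t1 : 0 < tau + c by exact: ltr_wpDl.
have t2 : 0 < tau + c' by rewrite ltr_wpDl// (lt_le_trans c0).
rewrite ler_pdivrMr// mulrAC ler_pdivlMr//.
by have := ler_wpM2l tau_ge0 cc'; lra.
Qed.

Let q_le c c' d : 0 < c -> c <= c' -> q c d <= q c' d.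
Proof.
move=> c0 cc'; rewrite /q; apply: lerD; last exact: ler_wpM2r.
by rewrite lerD2l; apply: ler_wpM2r => //; exact: ratio_le.
Qed.

Let q_pos d : d != 0 -> exists k : nat, 0 < q k.+1%:R d.
Proof.
move=> d0; have [Bd|Bd] := eqVneq (B d) 0.
  have hp := pos d0 Bd.
  (* The threshold comes from [(tau + c) q c d = (tau + c) (H d + P d) - tau * P d], valid when
     [B d = 0]. *)
  have b0 : 0 <= tau * P d / (H d + P d) by rewrite divr_ge0 ?mulr_ge0// ltW.
  have := archi_boundP b0; set k := Num.bound _ => hk.
  exists k; rewrite /q Bd mulr0 addr0.
  have k1 : tau * P d / (H d + P d) < k.+1%:R by apply: lt_trans hk _;
    rewrite ltr_nat.
  move: k1; rewrite ltr_pdivrMr// => k1.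
  have tk : 0 < tau + k.+1%:R by rewrite ltr_wpDl.
  rewrite -(pmulr_rgt0 _ tk).
  have -> : (tau + k.+1%:R) * (H d + k.+1%:R / (tau + k.+1%:R) * P d) =
      tau * H d + k.+1%:R * (H d + P d) by field; rewrite gt_eqF.
  by have := mulr_ge0 tau_ge0 (ltW hp); lra.
have Bp : 0 < B d by rewrite lt_neqAle eq_sym Bd B_ge0.
have b0 : 0 <= `|H d| / B d by rewrite divr_ge0// ltW.
have := archi_boundP b0; set k := Num.bound _ => hk.
exists k; rewrite /q.
have k1 : `|H d| / B d < k.+1%:R by apply: lt_trans hk _; rewrite ltr_nat.
move: k1; rewrite ltr_pdivrMr// => k1.
have r0 : 0 <= k.+1%:R / (tau + k.+1%:R) * P d.
  by rewrite mulr_ge0// divr_ge0// addr_ge0.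
have := ler_norm (- H d); rewrite normrN; lra.
Qed.

Let q_cont c : continuous (fun v : 'rV[R]_n => q c v^T).
Proof.
move=> v.
have t : (w^T @[w --> v] --> v^T) by apply: (@cvg_trmx _ _ (nbhs v));
  exact: cvg_id.
have cH : H w^T @[w --> v] --> H v^T by exact: (cvg_comp _ _ t (@H_cont v^T)).
have cP : P w^T @[w --> v] --> P v^T by exact: (cvg_comp _ _ t (@P_cont v^T)).
have cB : B w^T @[w --> v] --> B v^T by exact: (cvg_comp _ _ t (@B_cont v^T)).
apply: (@cvgD _ _ _ (nbhs v)).
  apply: (@cvgD _ _ _ (nbhs v)) => //.
  by apply: (@cvgM _ _ (nbhs v) _ (fun=> c / (tau + c))) => //; exact: cvg_cst.
by apply: (@cvgM _ _ (nbhs v) _ (fun=> c)) => //; exact: cvg_cst.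
Qed.

(* [q] is nondecreasing in [c], so the sets where it is positive exhaust the
   compact unit sphere. *)
Lemma penalty_coercive : exists cbar eta : R, [/\ 0 < cbar, 0 < eta &
  forall c, cbar <= c -> forall d,
    eta * enorm d ^+ 2 <= H d + c / (tau + c) * P d + c * B d].
Proof.
pose S := [set v : 'rV[R]_n | dot v^T v^T = 1].
have S0 v : S v -> v^T != 0 by rewrite /S/= -dot_gt0 => ->.
have cS : compact S by exact: compact_unit_sphere.
have [k qk] : exists k : nat, forall v, S v -> 0 < q k.+1%:R v^T.
  have := (compact_near_coveringP S).1 cS nat \oo (fun k v => 0 < q k.+1%:R
    v^T) _.
  case; last by move=> N _ /(_ N (leqnn N)) h; exists N => v Sv; exact: h.
  move=> v Sv; have [k qk] := q_pos (S0 _ Sv).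
  have h1 : \forall w \near v, 0 < q k.+1%:R w^T.
    have c : q k.+1%:R w^T @[w --> v] --> q k.+1%:R v^T by exact: q_cont.
    exact: (@cvgr_gt _ _ (nbhs v) _ (fun w => q k.+1%:R w^T) _ c 0 qk).
  near=> w N => /=.
  apply: (@lt_le_trans _ _ (q k.+1%:R w^T)); first by near: w.
  apply: q_le => //; rewrite ler_nat ltnS.
  by near: N; exact: nbhs_infty_ge.
have k0 : (0 : R) < k.+1%:R by [].
have [eta eta0 qeta] : exists2 eta : R, 0 < eta & forall v, S v -> eta <= q
  k.+1%:R v^T.
  (* The sphere is empty when [n = 0]; any positive [eta] then does. *)
  have [S_ne|S_e] := pselect (S !=set0); last first.
    by exists 1 => // v Sv; case: S_e; exists v.
  have [w wS wmin] := EVT_min_rV S_ne cS (continuous_subspaceT (@q_cont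
    k.+1%:R)).
  exists (q k.+1%:R w^T); first by apply: qk; rewrite inE in wS.
  by move=> v Sv; apply: wmin; rewrite inE.
exists k.+1%:R, eta; split=> // c kc d; rewrite -/(q c d).
have [->|d0] := eqVneq d 0.
  rewrite enorm0 expr0n mulr0 -(scale0r (0 : 'cV[R]_n)) /q H_hom P_hom B_hom.
  by rewrite expr0n /= !mul0r !mulr0 !addr0.
have n0 : 0 < enorm d by rewrite enorm_gt0.
pose e := (enorm d)^-1 *: d.
have dE : d = enorm d *: e by rewrite /e scalerA mulfV ?scale1r// gt_eqF.
have Se : S e^T.
  rewrite /S/= trmxK /e !dotZl !dotZr -sqr_enorm; field; exact: lt0r_neq0.
have := le_trans (qeta _ Se) (q_le _ k0 kc); rewrite trmxK => h.
have -> : q c d = q c e * enorm d ^+ 2.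
  by rewrite {1}dE /q H_hom P_hom B_hom; ring.
by rewrite ler_pM2r// exprn_gt0.
Unshelve. all: by end_near. Qed.

End penalty.

(** * One cone block *)

Section block_penalty.
Context {R : realType} {r : nat}.
Implicit Types (u v w y z g mu nu b : 'cV[R]_(r + 1)).

(** For a nonzero boundary vector [v] of the cone, the nonnegative multiples of this vector are
    exactly the cone elements orthogonal to [v]. *)
Definition soc_reflect v : 'cV[R]_(r + 1) := col_mx (- soc_bar v) (soc_dot
  v)%:M.

(* A nonnegative form that agrees with the block of the sigma term wherever
   [critical_gap] vanishes.  It is [0] when [g = 0], because [x / 0 = 0]. *)
Definition curvature_form mu g z : R := soc_dot mu / soc_dot g *
  (dot (soc_bar z) (soc_bar z) - (dot (soc_bar g) (soc_bar z) / soc_dot g) ^+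
    2).

(* Its zero set is the span of [T_Q(g)] intersected with [mu]-orthogonal
   vectors: everything, the line through the reflection of [mu] (or [0]), and
   the tangent hyperplane of the cone at [g], respectively. *)
Definition critical_gap mu g z : R :=
  if mu == 0 then 0
  else if g == 0 then dot z z - dot (soc_reflect mu) z ^+ 2 / (2 * soc_dot mu
    ^+ 2)
  else 2^-1 * (soc_dot z - dot (soc_bar g) (soc_bar z) / soc_dot g) ^+ 2.

Lemma dot_reflect v z :
  dot (soc_reflect v) z = soc_dot v * soc_dot z - dot (soc_bar v) (soc_bar z).
Proof. by rewrite dot_soc !soc_lin dotNl addrC. Qed.

Lemma sub_CS_ge0 g z : soc r g ->
  0 <= dot (soc_bar z) (soc_bar z) - (dot (soc_bar g) (soc_bar z) / soc_dot g)
    ^+ 2.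
Proof.
move=> gQ; have [->|g0] := eqVneq g 0.
  by rewrite !soc_lin dot0l mul0r expr0n subr0 dot_ge0.
have gd := soc_dot_gt0 gQ g0.
rewrite subr_ge0 expr_div_n ler_pdivrMr ?exprn_gt0//.
apply: le_trans (dot_CS _ _) _; rewrite mulrC ler_wpM2l ?dot_ge0//.
by rewrite -sqr_enorm ler_sqr ?nnegrE ?enorm_ge0// ltW.
Qed.

Lemma curvature_form_ge0 mu g z : soc r mu -> soc r g -> 0 <= curvature_form mu
  g z.
Proof.
move=> muQ gQ; rewrite mulr_ge0 ?sub_CS_ge0// divr_ge0 ?soc_dot_ge0//.
Qed.

(** [2 * soc_dot mu ^+ 2] bounds the squared norm of the reflection and equals it exactly when
    [enorm (soc_bar mu) = soc_dot mu]. This normalization lets one formula for the gap cover both an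
    interior and a boundary [mu]. *)
Lemma dot_reflect_CS mu z : soc r mu ->
  dot (soc_reflect mu) z ^+ 2 <= 2 * soc_dot mu ^+ 2 * dot z z.
Proof.
move=> muQ; apply: le_trans (dot_CS _ _) _; rewrite ler_wpM2r ?dot_ge0//.
rewrite dot_soc !soc_lin dotNl dotNr opprK -sqr_enorm.
have : enorm (soc_bar mu) ^+ 2 <= soc_dot mu ^+ 2.
  by rewrite ler_sqr ?nnegrE ?enorm_ge0//; exact: soc_dot_ge0.
lra.
Qed.

Lemma critical_gap_ge0 mu g z : soc r mu -> 0 <= critical_gap mu g z.
Proof.
move=> muQ; rewrite /critical_gap; case: eqVneq => // mu0; case: eqVneq => g0.
  have md := soc_dot_gt0 muQ mu0.
  rewrite subr_ge0 ler_pdivrMr ?mulr_gt0 ?exprn_gt0//.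
  by rewrite mulrC dot_reflect_CS.
by rewrite mulr_ge0 ?sqr_ge0.
Qed.

(** Prepares membership in the affine hull of the critical cone: [good] asks for orthogonality to
    [mu] and for the blockwise tangency criterion of [tangent_blocks]. If [mu = 0], adding a long
    enough axis vector brings any [z] into the cone; otherwise [z] or [- z] is good by itself. *)
Lemma critical_gap_eq0_split mu g z : soc r mu -> soc r g -> dot mu g = 0 ->
  critical_gap mu g z = 0 ->
  exists yw : 'cV[R]_(r + 1) * 'cV[R]_(r + 1), let good y := dot mu y = 0 /\
    (soc r y \/ [/\ enorm (soc_bar g) = soc_dot g, 0 < soc_dot g
      & dot (soc_bar g) (soc_bar y) = soc_dot g * soc_dot y]) in
    [/\ z = yw.1 - yw.2, good yw.1 & good yw.2].
Proof.
move=> muQ gQ mug; rewrite /critical_gap; case: eqVneq => [-> _|mu0].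
  pose e : 'cV[R]_(r + 1) := col_mx 0 (enorm (soc_bar z) + `|soc_dot z|)%:M.
  exists (z + e, e); split=> /=; first by rewrite addrK.
    split; [exact: dot0l|left]; rewrite socE !soc_lin addr0.
    by have := ler_norm (- soc_dot z); rewrite normrN; lra.
  split; [exact: dot0l|left]; rewrite socE !soc_lin enorm0 addr_ge0//.
  exact: enorm_ge0.
have md := soc_dot_gt0 muQ mu0.
case: eqVneq => [_|g0].
  move/eqP; rewrite subr_eq0 => /eqP zz.
  set a := dot (soc_reflect mu) z / (2 * soc_dot mu ^+ 2).
  have rr : dot (soc_reflect mu) (soc_reflect mu) =
      enorm (soc_bar mu) ^+ 2 + soc_dot mu ^+ 2.
    by rewrite dot_soc !soc_lin dotNl dotNr opprK sqr_enorm expr2.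
  have mule : enorm (soc_bar mu) ^+ 2 <= soc_dot mu ^+ 2.
    by rewrite ler_sqr ?nnegrE ?enorm_ge0// ltW.
  have rz : dot (soc_reflect mu) z = a * (2 * soc_dot mu ^+ 2).
    by rewrite divfK// gt_eqF// mulr_gt0 ?exprn_gt0.
  have zz2 : dot z z = 2 * a ^+ 2 * soc_dot mu ^+ 2.
    by rewrite zz rz; field; rewrite gt_eqF.
  (* A square equals minus a nonnegative number, so both vanish: [z] is the multiple [a] of the
     reflection, and either [a = 0] or [mu] is on the boundary. In both cases [<mu, z> = 0]. *)
  have key : dot (z - a *: soc_reflect mu) (z - a *: soc_reflect mu) =
     - (a ^+ 2 * (soc_dot mu ^+ 2 - enorm (soc_bar mu) ^+ 2)).
    rewrite !dotDl !dotDr !dotNl !dotNr !dotZl !dotZr rr (dotC z) rz zz2; ring.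
  have a2 : 0 <= a ^+ 2 * (soc_dot mu ^+ 2 - enorm (soc_bar mu) ^+ 2).
    by rewrite mulr_ge0 ?sqr_ge0// subr_ge0.
  have k0 := dot_ge0 (z - a *: soc_reflect mu).
  have zE : z = a *: soc_reflect mu.
    by apply/eqP; rewrite -subr_eq0 -dot_eq0 eq_le k0 andbT key oppr_le0.
  have muz : dot mu z = 0.
    rewrite zE dotZr dot_soc !soc_lin dotNr -sqr_enorm addrC -expr2.
    have : a ^+ 2 * (soc_dot mu ^+ 2 - enorm (soc_bar mu) ^+ 2) = 0 by lra.
    by move/eqP; rewrite mulf_eq0 sqrf_eq0 -mulf_eq0 => /eqP.
  have rQ : soc r (soc_reflect mu) by rewrite socE !soc_lin enormN.
  have [a0|a0] := leP 0 a.
    exists (z, 0); split=> /=; first by rewrite subr0.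
      by split=> //; left; rewrite zE; exact: socZ.
    by rewrite dot0r; split=> //; left; exact: soc0.
  exists (0, - z); split=> /=; first by rewrite opprK add0r.
    by rewrite dot0r; split=> //; left; exact: soc0.
  split; first by rewrite dotNr muz oppr0.
  by left; rewrite zE -scaleNr; apply: socZ => //; lra.
have gd := soc_dot_gt0 gQ g0.
have [t0 mb mdE tE] := soc_compl gQ muQ g0 mug.
move/eqP; rewrite mulf_eq0 invr_eq0 pnatr_eq0 /= sqrf_eq0 subr_eq0 => /eqP zd.
have gz : dot (soc_bar g) (soc_bar z) = soc_dot g * soc_dot z.
  by rewrite zd mulrC divfK// gt_eqF.
have gb : enorm (soc_bar g) = soc_dot g by apply: tE;
  rewrite mulf_neq0 ?invr_eq0 ?gt_eqF.
exists (z, 0); split=> /=; first by rewrite subr0.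
  split; last by right.
  by rewrite dot_soc mb dotZl gz {2}mdE; ring.
by rewrite dot0r; split=> //; left; exact: soc0.
Qed.

(** From an interior point one could move a little down the axis inside the cone, and the pairing
    with [mu] would become [- h * soc_dot mu < 0], against self-duality. *)
Lemma notin_interior_soc mu g : soc r mu -> soc r g -> mu != 0 ->
  dot mu g = 0 -> bdry (soc r) g.
Proof.
move=> muQ gQ mu0 mug; split; first exact: subset_closure.
move=> gI; pose e : 'cV[R]_(r + 1) := col_mx 0 1%:M.
have c : g - h *: e @[h --> (0 : R)] --> g.
  rewrite -[X in _ --> X]subr0 -(scale0r e).
  by apply: cvgB; [exact: cvg_cst|apply: cvgZr_tmp; exact: cvg_id].
have c0 : \forall h \near (0 : R)^'+, soc r (g - h *: e).
  by apply: cvg_at_right_filter c _ gI.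
have : \forall h \near (0 : R)^'+, False.
  near=> h.
  have h0 : 0 < h by near: h; exact: nbhs_right_gt.
  have hQ : soc r (g - h *: e) by near: h.
  have := soc_dual muQ hQ; rewrite dotBr mug sub0r dotZr dot_soc !soc_lin dot0r.
  by rewrite add0r mulr1 oppr_ge0 leNgt mulr_gt0// soc_dot_gt0.
by move/filter_ex => [].
Unshelve. all: by end_near. Qed.

End block_penalty.

(** * Bounds for a B-subgradient block at the shifted point *)

Section block_lower_bounds.
Context {R : realType} {r : nat}.
Variables (c : R) (mu g z w : 'cV[R]_(r + 1)).
Hypotheses (c0 : 0 < c) (muQ : soc r mu) (gQ : soc r g) (mug : dot mu g = 0).
Let u := mu - c *: g.
Hypothesis zw_cases : [\/ soc r u /\ w = z, soc r (- u) /\ w = 0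
  | `|soc_dot u| <= enorm (soc_bar u) /\
    (soc_bar u != 0 -> dot z w = dot z (socjac u z))].

Lemma in_soc_g0 : soc r u -> g = 0.
Proof.
move=> uQ; apply/eqP; rewrite -dot_eq0 eq_le dot_ge0 andbT.
have := soc_dual uQ gQ; rewrite /u dotBl mug sub0r dotZl oppr_ge0.
by rewrite pmulr_rle0.
Qed.

Lemma in_polar_mu0 : soc r (- u) -> mu = 0.
Proof.
move=> uQ; apply/eqP; rewrite -dot_eq0 eq_le dot_ge0 andbT.
have := soc_dual uQ muQ; rewrite /u dotNl dotBl dotZl (dotC g) mug mulr0 subr0.
by rewrite oppr_ge0.
Qed.

(* Complementarity makes the vector part of [u] a negative multiple of that
   of [g], so the projection's Jacobian at [u] is expressed through [g]. *)
Lemma socjac_shift : g != 0 -> `|soc_dot u| <= enorm (soc_bar u) ->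
  [/\ enorm (soc_bar g) = soc_dot g, soc_bar u != 0
    & let t := soc_dot mu / soc_dot g in
      let a := dot (soc_bar g) (soc_bar z) / soc_dot g in
      dot z (socjac u z) = t / (t + c) * (dot (soc_bar z) (soc_bar z) - a ^+ 2)
        + 2^-1 * (soc_dot z - a) ^+ 2].
Proof.
move=> g0 uout; have gd := soc_dot_gt0 gQ g0.
have [] := soc_compl gQ muQ g0 mug.
set t := soc_dot mu / soc_dot g => t0 mb md tE.
have tc : 0 < t + c by exact: ltr_wpDl.
have ub : soc_bar u = - (t + c) *: soc_bar g.
  by rewrite /u !soc_lin mb opprD scalerBl !scaleNr.
have ud : soc_dot u = (t - c) * soc_dot g.
  by rewrite /u !soc_lin md; ring.
have nu : enorm (soc_bar u) = (t + c) * enorm (soc_bar g).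
  by rewrite ub enormZ normrN gtr0_norm.
have gb : enorm (soc_bar g) = soc_dot g.
  have [t_eq|t_neq] := eqVneq t 0; last exact: tE.
  apply/eqP; rewrite eq_le gQ/=; move: uout.
  by rewrite ud nu t_eq !add0r mulNr normrN normrM !gtr0_norm// ler_pM2l.
split=> //; first by rewrite -enorm_gt0 nu gb mulr_gt0.
move=> t' a; rewrite dot_socjac_diag /soc_ratio /soc_dir nu gb ud.
rewrite dotZl ub dotZl /a /t' -/t.
by field; rewrite !gt_eqF.
Qed.

(** For [mu = 0] both forms on the left vanish and only positivity is used. For [g = 0] the
    curvature vanishes, and the gap is at most [<z, z>], or equals the Jacobian's form when [mu] is
    on the boundary. If neither is zero only the third alternative survives, with equality for
    weight [c / (t + c)], then weakened to [c / (tau + c)]. *)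
Lemma block_lower_bound (tau : R) : soc_dot mu / soc_dot g <= tau ->
  0 <= dot z w ->
  c / (tau + c) * curvature_form mu g z + c * critical_gap mu g z <= c * dot z
    w.
Proof.
move=> ttau zw0; rewrite /critical_gap; case: eqVneq => [mu0|mu0].
  by rewrite /curvature_form mu0 soc_lin !mul0r !mulr0 addr0 mulr_ge0// ltW.
have md := soc_dot_gt0 muQ mu0.
case: eqVneq => [g0|g0].
  rewrite /curvature_form g0 !soc_lin invr0 mulr0 mul0r mulr0 add0r ler_pM2l//.
  have uE : u = mu by rewrite /u g0 scaler0 subr0.
  case: zw_cases => -[].
  - by move=> _ ->; rewrite lerBlDr lerDl divr_ge0 ?sqr_ge0// mulr_ge0 ?sqr_ge0.
  - by move=> /in_polar_mu0 /eqP; rewrite (negbTE mu0).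
  rewrite uE => mub h.
  have mb : enorm (soc_bar mu) = soc_dot mu.
    by apply/eqP; rewrite eq_le muQ/=; move: mub; rewrite gtr0_norm.
  rewrite h; last by rewrite -enorm_gt0 mb.
  rewrite dot_socjac_diag /soc_ratio /soc_dir mb dotZl dot_reflect dot_soc.
  by rewrite le_eqVlt; apply/orP; left; apply/eqP; field; rewrite gt_eqF.
have gd := soc_dot_gt0 gQ g0.
case: zw_cases => -[].
- by move=> /in_soc_g0 /eqP; rewrite (negbTE g0).
- by move=> /in_polar_mu0 /eqP; rewrite (negbTE mu0).
move=> uout h; have [gb ub0 E] := socjac_shift g0 uout.
rewrite (h ub0) E /curvature_form; have N0 := sub_CS_ge0 z gQ.
set N := dot _ _ - _ in N0 *.
have t0 : 0 <= soc_dot mu / soc_dot g by rewrite divr_ge0// ltW.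
move: (soc_dot mu / soc_dot g) ttau t0 => t ttau t0.
rewrite [leRHS]mulrDr lerD2r !mulrA ler_wpM2r// [leLHS]mulrAC.
apply: ler_wpM2l; first by rewrite mulr_ge0// ltW.
by rewrite lef_pV2 ?posrE ?lerD2r ?ltr_wpDl// (le_trans t0).
Qed.

(** For [g = 0] orthogonality is void and every vector is a difference of cone elements; in the
    polar case [z = 0]. Otherwise the eigenvalue [1] of [socjac] at the shifted point has as its
    eigenspace the line through [soc_reflect g], and [z] or [- z] lies on its cone side. *)
Lemma fixed_normal : w = z -> exists yw : 'cV[R]_(r + 1) * 'cV[R]_(r + 1),
  [/\ z = yw.1 - yw.2, soc r yw.1, soc r yw.2, dot yw.1 g = 0 & dot yw.2 g = 0].
Proof.
move=> wz; have [g0|g0] := eqVneq g 0.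
  pose e : 'cV[R]_(r + 1) := col_mx 0 (enorm (soc_bar z) + `|soc_dot z|)%:M.
  exists (z + e, e); split=> /=; rewrite ?addrK ?g0 ?dot0r//.
    rewrite socE !soc_lin addr0.
    by have := ler_norm (- soc_dot z); rewrite normrN; lra.
  by rewrite socE !soc_lin enorm0 addr_ge0// enorm_ge0.
have gd := soc_dot_gt0 gQ g0.
case: zw_cases => -[].
- by move=> /in_soc_g0 /eqP; rewrite (negbTE g0).
- move=> _ w0; exists (0, 0); rewrite /= subr0 -wz w0 dot0l.
  by split=> //; exact: soc0.
move=> uout h; have [gb ub0 E] := socjac_shift g0 uout.
have := h ub0; rewrite E wz; set t := soc_dot mu / soc_dot g.
set a := dot (soc_bar g) (soc_bar z) / soc_dot g => zz.
have t0 : 0 <= t by rewrite divr_ge0 ?(ltW gd)//; exact: soc_dot_ge0.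
have N0 := sub_CS_ge0 z gQ; rewrite -/a in N0.
have tc : 0 < t + c by exact: ltr_wpDl.
pose k := c / (t + c).
have k0 : 0 < k by rewrite divr_gt0.
(* This is [<z, z - w> = 0] in spectral form. The weight [k = 1 - t/(t + c)] is positive because
   [c > 0], so both terms vanish. *)
have zz2 : k * (dot (soc_bar z) (soc_bar z) - a ^+ 2) + 2^-1 * (soc_dot z + a)
  ^+ 2 = 0.
  have kE : k = 1 - t / (t + c) by rewrite /k; field; rewrite gt_eqF.
  by move: zz; rewrite kE dot_soc; lra.
have N0' := mulr_ge0 (ltW k0) N0.
have b0 := sqr_ge0 (soc_dot z + a).
have /eqP : (soc_dot z + a) ^+ 2 = 0 by lra.
rewrite sqrf_eq0 addr_eq0 => /eqP da.
have /eqP : k * (dot (soc_bar z) (soc_bar z) - a ^+ 2) = 0 by lra.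
rewrite mulf_eq0 gt_eqF//= subr_eq0 => /eqP za.
pose e := soc_reflect g.
have eQ : soc r e by rewrite socE !soc_lin enormN gb.
have eg : dot e g = 0 by rewrite dot_reflect -sqr_enorm gb expr2 subrr.
pose k' := soc_dot z / soc_dot g.
have zE : z = k' *: e.
  apply: soc_ext; rewrite !soc_lin; last by rewrite /k' divfK// gt_eqF.
  apply/eqP; rewrite -subr_eq0 -dot_eq0 scalerN opprK.
  rewrite !dotDl !dotDr !dotZl !dotZr za (dotC (soc_bar z)).
  have -> : dot (soc_bar g) (soc_bar z) = a * soc_dot g by rewrite /a divfK//
    gt_eqF.
  rewrite -(sqr_enorm (soc_bar g)) gb /k' da; apply/eqP; field.
  by rewrite gt_eqF.
have [k'0|k'0] := leP 0 k'.
  exists (z, 0); rewrite /= subr0 dot0l {3 4}zE dotZl eg mulr0; split=> //.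
    exact: socZ.
  exact: soc0.
exists (0, - z); rewrite /= opprK add0r dot0l {3 4}zE dotNl dotZl eg mulr0
  oppr0.
split=> //; first exact: soc0.
by rewrite -scaleNr; apply: socZ => //; lra.
Qed.

End block_lower_bounds.

(** * The optimality system *)

Section block_continuity.
Context {R : realType} {T : Type} {F : set_system T} {FF : Filter F}.

Lemma cvg_curvature_form r (mu g : 'cV[R]_(r + 1)) (x : T -> 'cV[R]_(r + 1))
    (a : 'cV[R]_(r + 1)) :
  x t @[t --> F] --> a -> curvature_form mu g (x t) @[t --> F] -->
    curvature_form mu g a.
Proof.
move=> xa; have ba := @cvg_soc_bar R T F FF _ _ _ xa.
have c1 : dot (soc_bar g) (soc_bar (x t)) / soc_dot g @[t --> F] -->
    dot (soc_bar g) (soc_bar a) / soc_dot g.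
  apply: (@cvgM _ _ _ _ _ (fun=> (soc_dot g)^-1)); last exact: cvg_cst.
  by apply: cvg_dot => //; exact: cvg_cst.
apply: (@cvgM _ _ _ _ (fun=> soc_dot mu / soc_dot g)); first exact: cvg_cst.
by apply: cvgB; [exact: cvg_dot|exact: (cvgM c1 c1)].
Qed.

Lemma cvg_critical_gap r (mu g : 'cV[R]_(r + 1)) (x : T -> 'cV[R]_(r + 1))
    (a : 'cV[R]_(r + 1)) :
  x t @[t --> F] --> a -> critical_gap mu g (x t) @[t --> F] --> critical_gap
    mu g a.
Proof.
move=> xa; have ba := @cvg_soc_bar R T F FF _ _ _ xa.
rewrite /critical_gap; case: eqVneq => _; first exact: cvg_cst.
case: eqVneq => _.
  have c1 : dot (soc_reflect mu) (x t) @[t --> F] --> dot (soc_reflect mu) a.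
    by apply: cvg_dot => //; exact: cvg_cst.
  apply: cvgB; first exact: cvg_dot.
  apply: (@cvgM _ _ _ _ _ (fun=> (2 * soc_dot mu ^+ 2)^-1));
    last exact: cvg_cst.
  exact: (cvgM c1 c1).
have c1 : soc_dot (x t) - dot (soc_bar g) (soc_bar (x t)) / soc_dot g @[t -->
  F] -->
    soc_dot a - dot (soc_bar g) (soc_bar a) / soc_dot g.
  apply: cvgB; first exact: cvg_soc_dot.
  apply: (@cvgM _ _ _ _ _ (fun=> (soc_dot g)^-1)); last exact: cvg_cst.
  by apply: cvg_dot => //; exact: cvg_cst.
apply: (@cvgM _ _ _ _ (fun=> 2^-1)); first exact: cvg_cst.
exact: (cvgM c1 c1).
Qed.

End block_continuity.

Section block_homogeneity.
Context {R : realType} {r : nat}.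
Implicit Types (mu g z : 'cV[R]_(r + 1)).

Lemma curvature_formZ mu g a z : curvature_form mu g (a *: z) = a ^+ 2 *
  curvature_form mu g z.
Proof. by rewrite /curvature_form !soc_lin !dotZr dotZl; ring. Qed.

Lemma critical_gapZ mu g a z : critical_gap mu g (a *: z) = a ^+ 2 *
  critical_gap mu g z.
Proof.
rewrite /critical_gap; case: eqVneq => _; first by rewrite mulr0.
case: eqVneq => _; first by rewrite !dotZr dotZl; ring.
by rewrite !soc_lin !dotZr; ring.
Qed.

End block_homogeneity.

(** * Uniqueness, coercivity and definiteness at the stationary point *)

Section kkt.
Context {R : realType} {n m s : nat} {r : 'I_s -> nat}.
Variables (f : 'cV[R]_n -> R) (h : 'cV[R]_n -> 'cV[R]_m).
Variable g : 'cV[R]_n -> 'cV[R]_(pdim r).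
Hypotheses (f_C2 : C2 f) (h_C2 : C2 h) (g_C2 : C2 g).
Variables (x : 'cV[R]_n) (lam : 'cV[R]_m) (mu : 'cV[R]_(pdim r)).
Hypothesis lam_mu : multipliers f h g x (lam, mu).
Hypothesis nondeg : constraint_nondegenerate h g x.
Hypothesis ssosc : strong_second_order f h g x lam mu.
Local Notation K := (socprod r).
Local Notation Jh := (jac h x).
Local Notation Jg := (jac g x).
Local Notation L2 := (hess (lagrangian f h g lam mu) x).

Let gK : K (g x). Proof. by case: lam_mu. Qed.
Let muK : K mu. Proof. by case: lam_mu. Qed.
Let mug : dot mu (g x) = 0. Proof. by case: lam_mu. Qed.
Let mugj j : dot (blk mu j) (blk (g x) j) = 0.
Proof. exact: socprod_compl. Qed.

Lemma multipliers_unique : multipliers f h g x = [set (lam, mu)].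
Proof.
apply/seteqP; split=> [[l v]|_ ->//] [/= Lv _ _ vK vg].
have [/= Lm _ _ _ _] := lam_mu.
have [] := @nondeg_dual _ _ _ _ _ _ _ _ nondeg (l - lam) (v - mu).
- rewrite !mulmxBr; move: Lv Lm; rewrite !grad_lagrangian// => Lv Lm.
  have : grad f x - Jh^T *m lam - Jg^T *m mu - (grad f x - Jh^T *m l - Jg^T *m
    v) = 0.
    by rewrite Lv Lm subrr.
  move=> <-; rewrite !opprD !opprK;
    move: (grad f x) (Jh^T *m lam) (Jg^T *m mu) (Jh^T *m l) (Jg^T *m v) => A B
    C D E.
  by apply/matrixP => i k; rewrite !mxE; ring.
- by move=> w wT; rewrite dotBl !(lin_tangent_perp _ _ wT)// subrr.
- by move=> /eqP + /eqP; rewrite !subr_eq0 => /eqP-> /eqP->.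
Qed.

Let quadP d := \sum_j curvature_form (blk mu j) (blk (g x) j) (blk (Jg *m d) j).
Let quadB d := dot (Jh *m d) (Jh *m d)
  + \sum_j critical_gap (blk mu j) (blk (g x) j) (blk (Jg *m d) j).

(** The sigma block gives [t (|z_bar|^2 - z_dot^2)]; for nonzero [mu_j] and [g_j], a vanishing gap
    says precisely [z_dot = <g_bar, z_bar>/g_dot]. *)
Lemma dot_sigmaH_block j d :
  critical_gap (blk mu j) (blk (g x) j) (blk (Jg *m d) j) = 0 ->
  dot d (sigmaH_block g x mu j *m d) = curvature_form (blk mu j) (blk (g x) j)
    (blk (Jg *m d) j).
Proof.
have dg : differentiable g x by exact: g_C2.1.
rewrite /sigmaH_block; set G := blk (g x) j; set M := blk mu j.
set z := blk _ j.
have jE : jac (fun y => blk (g y) j) x *m d = z by rewrite jac_blk.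
case: ifPn => [/asboolP[Gb /eqP G0] pz|Gn pz].
  rewrite -scalemxAl dotZr -!mulmxA -dot_tr trmxK jE.
  have -> : block_mx (- 1%:M) 0 0 1%:M *m z = col_mx (- soc_bar z) (soc_dot
    z)%:M.
    rewrite -{1}(soc_col_mx z) mul_block_col !mul0mx add0r addr0 mul1mx mulNmx.
    by rewrite mul1mx.
  rewrite dot_soc !soc_lin dotNr /curvature_form.
  have Gd := soc_dot_gt0 (gK j) G0.
  have [M0|M0] := eqVneq M 0.
    by rewrite M0 !soc_lin !mul0r oppr0 mul0r.
  move: pz; rewrite /critical_gap (negbTE M0) (negbTE G0) => /eqP.
  rewrite mulf_eq0 invr_eq0 pnatr_eq0 /= sqrf_eq0 subr_eq0 => /eqP <-.
  by ring.
rewrite mul0mx dot0r /curvature_form.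
have [M0|M0] := eqVneq M 0; first by rewrite M0 soc_lin !mul0r.
have [G0|G0] := eqVneq G 0; first by rewrite G0 !soc_lin invr0 mulr0 mul0r.
(* With both blocks nonzero, complementarity puts [g_j] on the boundary, contrary to the branch
   where the sigma block is [0] by definition. *)
case/negP: Gn; apply/asboolP; split; last exact/eqP.
exact: (notin_interior_soc (muK j) (gK j) M0 (mugj j)).
Qed.

Lemma quad_pos d : d != 0 -> quadB d = 0 -> 0 < dot d (L2 *m d) + quadP d.
Proof.
move=> d0 /eqP; rewrite paddr_eq0 ?dot_ge0//; last first.
  by apply: sumr_ge0 => j _; exact: critical_gap_ge0.
rewrite dot_eq0 psumr_eq0 => [/andP[/eqP hd /allP pd]|j _];
  last exact: critical_gap_ge0.
have {}pd j : critical_gap (blk mu j) (blk (g x) j) (blk (Jg *m d) j) = 0.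
  by apply/eqP/(pd j (mem_index_enum j)).
pose yw j := projT1 (cid (critical_gap_eq0_split (muK j) (gK j) (mugj j) (pd
  j))).
have ywP j := projT2 (cid (critical_gap_eq0_split (muK j) (gK j) (mugj j) (pd
  j))).
pose y : 'cV[R]_(pdim r) := \mxcol_j (yw j).1.
pose w : 'cV[R]_(pdim r) := \mxcol_j (yw j).2.
have gd : Jg *m d = y - w.
  apply: blk_ext => j; rewrite blkD blkN !blk_mxcol.
  by have [] := ywP j.
have yT : tangent_cone K (g x) y.
  apply: tangent_blocks => // j; rewrite blk_mxcol.
  by have [_ [_ ?] _] := ywP j.
have wT : tangent_cone K (g x) w.
  apply: tangent_blocks => // j; rewrite blk_mxcol.
  by have [_ _ [_ ?]] := ywP j.
have muy : dot mu y = 0.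
  rewrite dot_blk big1// => j _; rewrite blk_mxcol.
  by have [_ [? _] _] := ywP j.
have muw : dot mu w = 0.
  rewrite dot_blk big1// => j _; rewrite blk_mxcol.
  by have [_ _ [? _]] := ywP j.
have := ssosc (aff_critical nondeg muK mug hd gd yT wT muy muw) d0.
rewrite mulmxDl dotDr /sigmaH mulmx_suml /quadP.
have -> : dot d (\sum_j (sigmaH_block g x mu j *m d)) =
    \sum_j curvature_form (blk mu j) (blk (g x) j) (blk (Jg *m d) j).
  rewrite linear_sum; apply: eq_bigr => j _; exact: dot_sigmaH_block.
by [].
Qed.

Lemma dot_Amx c W y : dot y (Amx f h g c x lam mu W *m y) =
  dot y (L2 *m y) + c * dot (Jh *m y) (Jh *m y)
  + c * \sum_j dot (blk (Jg *m y) j) (blk (W *m (Jg *m y)) j).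
Proof.
rewrite /Amx !mulmxDl !dotDr -!scalemxAl !dotZr -!mulmxA.
by rewrite -!(dot_tr _^T) !trmxK dot_blk.
Qed.

Let shift_cases c W j z : Bsubdiff (eproj K) (mu - c *: g x) W ->
  [\/ soc (r j) (blk mu j - c *: blk (g x) j) /\ blk (W *m z) j = blk z j,
      soc (r j) (- (blk mu j - c *: blk (g x) j)) /\ blk (W *m z) j = 0
    | `|soc_dot (blk mu j - c *: blk (g x) j)| <=
         enorm (soc_bar (blk mu j - c *: blk (g x) j)) /\
      (soc_bar (blk mu j - c *: blk (g x) j) != 0 ->
       dot (blk z j) (blk (W *m z) j) =
         dot (blk z j) (socjac (blk mu j - c *: blk (g x) j) (blk z j)))].
Proof.
move=> WB; have := Bsubdiff_cases WB j; rewrite blkD blkN blkZ.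
by case=> -[u1 u2]; [apply: Or31|apply: Or32|apply: Or33; split=> // ?;
  exact: u2].
Qed.

Lemma Amx_coercive : exists cbar eta : R, [/\ 0 < cbar, 0 < eta &
  forall c, cbar <= c -> forall W, Bsubdiff (eproj K) (mu - c *: g x) W ->
  forall y, eta * enorm y ^+ 2 <= dot y (Amx f h g c x lam mu W *m y)].
Proof.
(* A sum of nonnegative ratios bounds each of them; a block with [g_j = 0] contributes [0], division
   by zero being [0]. *)
pose tau := \sum_j soc_dot (blk mu j) / soc_dot (blk (g x) j).
have t0 j : 0 <= soc_dot (blk mu j) / soc_dot (blk (g x) j).
  by rewrite divr_ge0//; apply: soc_dot_ge0; [exact: muK|exact: gK].
have tau_j j : soc_dot (blk mu j) / soc_dot (blk (g x) j) <= tau.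
  by rewrite /tau (bigD1 j)//= lerDl sumr_ge0.
have cvM p (A : 'M[R]_(p, n)) (v : 'cV[R]_n) : A *m w @[w --> v] --> A *m v.
  by apply: (@cvg_mulmx _ _ (nbhs v)); [exact: cvg_cst|exact: cvg_id].
have cvB j (v : 'cV[R]_n) : blk (Jg *m w) j @[w --> v] --> blk (Jg *m v) j.
  by apply: (@cvg_blk _ _ (nbhs v)); exact: cvM.
have [||||||||||cbar [eta [cbar0 eta0 H]]] := @penalty_coercive R n
  (fun d => dot d (L2 *m d)) quadP quadB tau.
- by move=> a d; rewrite -scalemxAr dotZl dotZr mulrA expr2.
- move=> a d; rewrite /quadP mulr_sumr; apply: eq_bigr => j _.
  by rewrite -scalemxAr blkZ curvature_formZ.
- move=> a d; rewrite /quadB -!scalemxAr dotZl dotZr mulrDr mulr_sumr mulrA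
  -expr2.
  by congr (_ + _); apply: eq_bigr => j _; rewrite blkZ critical_gapZ.
- move=> v; apply: (@cvg_dot _ _ (nbhs v) _ _ id); first exact: cvg_id.
  exact: cvM.
- move=> v; apply: (@cvg_bigsum _ _ (nbhs v)) => j.
  by apply: (@cvg_curvature_form _ _ (nbhs v)); exact: cvB.
- move=> v; apply: (@cvgD _ _ _ (nbhs v)).
    by apply: (@cvg_dot _ _ (nbhs v)); exact: cvM.
  apply: (@cvg_bigsum _ _ (nbhs v)) => j.
  by apply: (@cvg_critical_gap _ _ (nbhs v)); exact: cvB.
- by move=> d; apply: sumr_ge0 => j _; apply: curvature_form_ge0;
  [exact: muK|exact: gK].
- move=> d; rewrite addr_ge0 ?dot_ge0// sumr_ge0// => j _.
  by apply: critical_gap_ge0; exact: muK.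
- by apply: sumr_ge0 => j _.
- by move=> d; exact: quad_pos.
exists cbar, eta; split=> // c cc W WB y.
have c0 : 0 < c by exact: lt_le_trans cc.
apply: le_trans (H c cc y) _; rewrite dot_Amx /quadP /quadB mulrDr !addrA.
rewrite -!addrA lerD2l addrCA lerD2l !mulr_sumr -big_split /=.
apply: ler_sum => j _.
apply: (block_lower_bound c0 (muK j) (gK j) (mugj j) _ (tau_j j)).
  exact: shift_cases.
exact: (Bsubdiff_ge0 WB).
Qed.

Lemma fixed_eq0 c W (a : 'cV[R]_m) (b : 'cV[R]_(pdim r)) : 0 < c -> Bsubdiff
  (eproj K) (mu - c *: g x) W ->
  W *m b = b -> Jh^T *m a + Jg^T *m b = 0 -> a = 0 /\ b = 0.
Proof.
move=> c0 WB Wb ab0; apply: nondeg_dual nondeg _ _ ab0 _ => w wT.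
have key j := fixed_normal c0 (muK j) (gK j) (mugj j) (shift_cases j b WB)
  (congr1 (fun v => blk v j) Wb).
pose yw j := projT1 (cid (key j)).
have ywP j := projT2 (cid (key j)).
pose y : 'cV[R]_(pdim r) := \mxcol_j (yw j).1.
pose z : 'cV[R]_(pdim r) := \mxcol_j (yw j).2.
have bE : b = y - z.
  apply: blk_ext => j; rewrite blkD blkN !blk_mxcol.
  by have [] := ywP j.
have yK : K y by move=> j; rewrite blk_mxcol; have [] := ywP j.
have zK : K z by move=> j; rewrite blk_mxcol; have [] := ywP j.
have yg : dot y (g x) = 0.
  by rewrite dot_blk big1// => j _; rewrite blk_mxcol; have [] := ywP j.
have zg : dot z (g x) = 0.
  by rewrite dot_blk big1// => j _; rewrite blk_mxcol; have [] := ywP j.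
by rewrite bE dotBl (lin_tangent_perp yK yg wT) (lin_tangent_perp zK zg wT)
  subrr.
Qed.

(** With [p = A^-1 B^T z], the form is [- <p, A p> - (|b|^2 - <b, W b>)/c]. The first term is
    controlled by coercivity, the second by [|b - W b|^2 <= |b|^2 - <b, W b>], which is firmness of
    [W]. If the form is not negative, then [p = 0], so [B^T z = 0], and [W b = b] removes [W] from
    this equation. *)
Lemma dualV_negdef c eta V : 0 < c -> 0 < eta ->
  (forall W, Bsubdiff (eproj K) (mu - c *: g x) W ->
    forall y, eta * enorm y ^+ 2 <= dot y (Amx f h g c x lam mu W *m y)) ->
  dualV f h g c x lam mu V -> negdef V.
Proof.
move=> c0 eta0 coer [W WB ->].
have Wsym := Bsubdiff_sym WB.
set A := Amx _ _ _ _ _ _ _ _; set D := block_mx _ _ _ _.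
set B := col_mx Jh (W *m Jg).
have Apos y : eta * enorm y ^+ 2 <= dot y (A *m y) by exact: coer.
have BT : row_mx Jh^T (Jg^T *m W) = B^T by rewrite /B tr_col_mx trmx_mul Wsym.
rewrite BT.
have Asym : A^T = A.
  rewrite /A /Amx !linearD /= !linearZ /= hess_sym; last exact: lagrangian_C2.
  by rewrite !trmx_mul !trmxK Wsym mulmxA.
(* [invmx] is a genuine inverse only for invertible matrices; coercivity makes the kernel of [A]
   trivial. *)
have Aunit : A \in unitmx.
  rewrite -row_free_unit -kermx_eq0; apply/rowV0P => v /sub_kermxP vA.
  apply/eqP; rewrite -trmx_eq0 -enorm_eq0.
  have := Apos v^T; rewrite -[A in X in _ <= X]Asym -trmx_mul vA trmx0 dot0r.
  by rewrite pmulr_rle0// -sqrf_eq0 => e0; rewrite eq_le e0 sqr_ge0.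
split.
  rewrite linearB linearN /= !trmx_mul trmxK trmx_inv Asym mulmxA.
  by rewrite /D tr_block_mx !trmx0 linearZ /= linearB /= trmx1 Wsym.
move=> z z0.
set p := invmx A *m (B^T *m z).
have Ap : A *m p = B^T *m z by rewrite mulmxA mulmxV// mul1mx.
set a := usubmx z; set b := dsubmx z.
have zE : z = col_mx a b by rewrite vsubmxK.
have E1 : dot z ((- (B *m invmx A *m B^T) - D) *m z) =
    - dot p (A *m p) - c^-1 * (dot b b - dot b (W *m b)).
  rewrite mulmxBl mulNmx dotDr !dotNr; congr (- _ - _).
    by rewrite -!mulmxA -/p -(dot_tr B) -Ap dotC.
  rewrite /D zE mul_block_col !mul0mx !add0r dot_col_mx dot0r add0r.
  by rewrite -scalemxAl mulmxBl mul1mx dotZr dotBr.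
have firm : dot (W *m b) (W *m b) <= dot b (W *m b).
  by rewrite !dot_blk; apply: ler_sum => j _; exact: Bsubdiff_firm WB j _.
have fix_ge0 : dot (b - W *m b) (b - W *m b) <= dot b b - dot b (W *m b).
  by rewrite !dotBl !dotBr (dotC (W *m b) b); lra.
have pos2 := dot_ge0 (b - W *m b).
have Ap0 := Apos p.
have ep : 0 <= eta * enorm p ^+ 2 by rewrite mulr_ge0 ?sqr_ge0// ltW.
have ci : 0 < c^-1 by rewrite invr_gt0.
have cpos : 0 <= c^-1 * (dot b b - dot b (W *m b)).
  by rewrite mulr_ge0// ?(ltW ci)// (le_trans pos2).
rewrite E1 ltNge; apply/negP => ge0.
have /eqP : eta * enorm p ^+ 2 = 0 by apply/eqP; rewrite eq_le ep andbT; lra.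
rewrite mulf_eq0 gt_eqF//= sqrf_eq0 enorm_eq0 => /eqP p0.
have : c^-1 * (dot b b - dot b (W *m b)) = 0.
  by apply/eqP; rewrite eq_le cpos andbT; lra.
move/eqP; rewrite mulf_eq0 gt_eqF//= => /eqP bb.
have /eqP : dot (b - W *m b) (b - W *m b) = 0.
  by apply/eqP; rewrite eq_le pos2 andbT -bb.
rewrite dot_eq0 subr_eq0 => /eqP Wb.
have : Jh^T *m a + Jg^T *m b = 0.
  by move: Ap; rewrite p0 mulmx0 -BT zE mul_row_col -mulmxA -Wb => <-.
move=> /(fixed_eq0 c0 WB (esym Wb)) [a0 b0].
by move/eqP: z0; apply; rewrite zE a0 b0 col_mx0.
Qed.

End kkt.

Theorem theorem5p4 (R : realType) (n m s : nat) (r : 'I_s -> nat)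
  (f : 'cV[R]_n -> R) (h : 'cV[R]_n -> 'cV[R]_m)
  (g : 'cV[R]_n -> 'cV[R]_(pdim r))
  (f_C2 : C2 f) (h_C2 : C2 h) (g_C2 : C2 g)
  (x : 'cV[R]_n) (lam : 'cV[R]_m) (mu : 'cV[R]_(pdim r))
  (x_stat : stationary f h g x)
  (lam_mu : multipliers f h g x (lam, mu))
  (nondeg : constraint_nondegenerate h g x)
  (ssosc : strong_second_order f h g x lam mu) :
  multipliers f h g x = [set (lam, mu)] /\
  exists cbar eta : R,
    [/\ 0 < cbar, 0 < eta,
        forall c, cbar <= c ->
          forall W, Bsubdiff (eproj (socprod r)) (mu - c *: g x) W ->
          forall y, eta * enorm y ^+ 2 <= dot y (Amx f h g c x lam mu W *m y)
      & forall c, cbar <= c ->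
          forall V, dualV f h g c x lam mu V -> negdef V].
Proof.
split; first exact: multipliers_unique.
have [cbar [eta [cbar0 eta0 coer]]] :=
  Amx_coercive g_C2 lam_mu nondeg ssosc.
exists cbar, eta; split=> // c cc V.
have c0 : 0 < c by exact: lt_le_trans cc.
exact: dualV_negdef (coer c cc).
Qed.
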